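(* Let $k$ be a field, let $1\le t<n<v$ be integers, let $(V,B)$ be a Steiner system of type $S(t,n,v)$ with $V=\{1,\dots,v\}$, and let $\mathcal H=\{H_1,\dots,H_v\}$ be a collection of $v$ distinct hyperplanes in $\mathbb P^n_k$ such that any $n$ of them meet in exactly one point and any $n+1$ of them have empty intersection. Let $I\subseteq R=k[x_0,\dots,x_n]$ be the ideal defining the Complement of the Steiner configuration of points associated to $(V,B)$ with respect to $\mathcal H$, and let $\mathcal M=(x_0,\dots,x_n)$. Then: \begin{enumerate} \item (Stable Harbourne--Huneke Conjecture for $I$) for all $r\gg 0$, $$I^{(nr)}\subseteq \mathcal M^{r(n-1)}I^r\qquad\text{and}\qquad I^{(nr-n+1)}\subseteq \mathcal M^{(r-1)(n-1)}I^r;$$ \item (Stable Harbourne Conjecture for $I$) for all $r\gg 0$, $$I^{(nr-n+1)}\subseteq I^r .$$ \end{enumerate} (Here $n$ is the big height of $I$.)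
   Context: A Steiner system $(V,B)$ of type $S(t,n,v)$ is a set $V$ with $|V|=v$ together with a collection $B$ of $n$-element subsets of $V$ (blocks) such that each $t$-element subset of $V$ is contained in a unique block. Let $\ell_j\in R=k[x_0,\dots,x_n]$ be a linear form defining $H_j$. For an $n$-element subset $\sigma=\{\sigma_1,\dots,\sigma_n\}\subseteq V$, let $P_{\mathcal H,\sigma}=H_{\sigma_1}\cap\dots\cap H_{\sigma_n}$, a point of $\mathbb P^n_k$ with vanishing ideal $I_{P_{\mathcal H,\sigma}}=(\ell_{\sigma_1},\dots,\ell_{\sigma_n})$. Let $C_{(n,v)}$ be the set of all $n$-element subsets of $V$. The Complement of the Steiner configuration of points is $X_C=\bigcup_{\sigma\in C_{(n,v)}\setminus B}P_{\mathcal H,\sigma}$, with defining ideal $I=\bigcap_{\sigma\in C_{(n,v)}\setminus B}I_{P_{\mathcal H,\sigma}}$. For a radical ideal $I$, the $m$-th symbolic power is $I^{(m)}=\bigcap_{\mathfrak p\in \mathrm{Ass}(I)}\mathfrak p^m$; here $I^{(m)}=\bigcap_{\sigma\in C_{(n,v)}\setminus B}I_{P_{\mathcal H,\sigma}}^m$. The big height of an ideal is the maximum of the heights of its associated primes. *)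

(* Defs.v *)
From HB Require Import structures.
From mathcomp Require Import all_boot all_order all_algebra.
From mathcomp Require Import boolp classical_sets.
From mathcomp Require Import mpoly.

Set Implicit Arguments.
Unset Strict Implicit.
Unset Printing Implicit Defensive.

Import GRing.Theory.

Local Open Scope classical_set_scope.
Local Open Scope ring_scope.

(* The ideals of ring_quotient are boolean predicates and proper by definition;
   here an ideal is an arbitrary set of ring elements, possibly the unit
   ideal. *)
Section Ideals.
Context (R : comNzRingType).
Implicit Types (I J P : set R).

Definition is_ideal I : Prop :=
  [/\ I 0, forall a b, I a -> I b -> I (a + b) & forall a b, I b -> I (a * b)].

Definition prime_ideal P : Prop :=
  [/\ is_ideal P, ~ P 1 & forall a b, P (a * b) -> P a \/ P b].

Definition ideal_gen (S : set R) : set R := smallest is_ideal S.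

Definition ideal_mul I J : set R :=
  ideal_gen [set c | exists a b, [/\ I a, J b & c = a * b]].

Fixpoint ideal_exp I (m : nat) : set R :=
  if m is m'.+1 then ideal_mul I (ideal_exp I m') else setT.

(* Ass(I) means Ass(R/I): the prime ideals of the form I : f. *)
Definition assoc_prime I P : Prop :=
  prime_ideal P /\ exists f, P = [set g | I (g * f)].

Definition symbolic_power I (m : nat) : set R :=
  \bigcap_(P in assoc_prime I) ideal_exp P m.

(* c 0 < c 1 < ... < c h = P; the values of c beyond h are irrelevant. *)
Definition prime_chain_to P (h : nat) (c : nat -> set R) : Prop :=
  [/\ forall i, (i <= h)%N -> prime_ideal (c i),
      forall i, (i < h)%N -> c i `<` c i.+1
    & c h = P].

Definition has_height P (h : nat) : Prop :=
  (exists c, prime_chain_to P h c) /\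
  (forall h' c, prime_chain_to P h' c -> (h' <= h)%N).

Definition has_big_height I (h : nat) : Prop :=
  (exists2 P, assoc_prime I P & has_height P h) /\
  (forall P, assoc_prime I P -> exists2 h', has_height P h' & (h' <= h)%N).

End Ideals.

Definition steiner_system (V : finType) (t n : nat) (B : {set {set V}}) : Prop :=
  (forall b, b \in B -> #|b| = n) /\
  (forall T : {set V}, #|T| = t -> exists! b, (b \in B) && (T \subset b)).

(* The k-rational points of P^n, as the lines through the origin of k^(n+1).
   Intersections of hyperplanes are linear, so whether they are empty or a
   single point can be read on rational points over any field, even finite. *)
Definition proj_space (k : fieldType) (n : nat) : Type :=
  {p : {vspace 'rV[k]_n.+1} | \dim p == 1%N}.

Section Configurations.
Context (k : fieldType) (n v : nat).
Local Notation R := {mpoly k[n.+1]}.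

Definition linear_form (f : R) : Prop := f \is 1.-homog.

Definition hyperplane (f : R) : set (proj_space k n) :=
  [set p : proj_space k n |
    forall u : 'rV[k]_n.+1, u \in sval p -> f.@[u 0] = 0].

Definition irrelevant_ideal : set R :=
  ideal_gen [set f | exists i : 'I_n.+1, f = 'X_i].

Definition point_ideal (l : 'I_v -> R) (s : {set 'I_v}) : set R :=
  ideal_gen [set f | exists2 j, j \in s & f = l j].

Definition complement_ideal (B : {set {set 'I_v}}) (l : 'I_v -> R) : set R :=
  \bigcap_(s in [set s : {set 'I_v} | #|s| = n /\ s \notin B]) point_ideal l s.

End Configurations.

Arguments irrelevant_ideal : clear implicits.

(* Main.v *)
Require Import Defs.
From mathcomp Require Import all_boot all_order all_algebra.
From mathcomp Require Import boolp classical_sets.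
From mathcomp Require Import mpoly.
From mathcomp Require Import zify ring.

(** Write I_S for the ideal of the forms indexed by S.  Any n + 1 of the forms are
    linear coordinates, in which the ideals I_S^m + I_T, for T contained in S, are
    monomial; their colon ideals are read off the exponents.

    Let X be the set of points, and e = v - n.  By restriction to a hyperplane,
    lifting, and division by its equation, every form of degree at least
    d + p (e + 1) vanishing to order p on X lies in M^d I^p.  It remains to bound
    degrees from below.  If a form f vanishing to order q on X does not vanish on
    H_j, then its restriction vanishes to order q on a similar configuration in
    H_j, which forces its degree up; otherwise f is divisible by the product L of
    all the forms, and f / L vanishes to order q - n.  Thus f has degree at least
    r v if q = n r; and if q = n (r - 1) + 1, either f has degree at least
    (r - 1) v + e + 1, which is enough, or f is a multiple of L, which lies in
    M^(n - 1) I, and we conclude by induction on r.  This dichotomy fails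
    only for S(1, 2, 4), where X is a complete intersection of two conics and is
    treated directly.

    A chain of primes ending at I_S, with S of size n, can be prolonged by M, so
    the height of I_S is at most n once chains of primes in n + 1 variables have
    length at most n + 1.  They do, because n + 2 polynomials are algebraically
    dependent, while elements chosen in the successive steps of a chain satisfy no
    relation, as one sees on its lexicographically least term. *)

Set Implicit Arguments.
Unset Strict Implicit.
Unset Printing Implicit Defensive.

Import GRing.Theory.

Local Open Scope classical_set_scope.
Local Open Scope ring_scope.

(** * Ideals *)

Section IdealTheory.
Context (R : comNzRingType).
Implicit Types (I J K S : set R) (a b c x : R) (m p : nat).

Lemma ideal_gen_ideal S : is_ideal (ideal_gen S).
Proof.
split=> [T [[T0 _ _] _] //|a b Sa Sb T TS|a b Sb T TS].
  by case: (TS) => -[_ TD _] _; apply: TD; [apply: Sa|apply: Sb].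
by case: (TS) => -[_ _ TM] _; apply: TM; apply: Sb.
Qed.

Lemma sub_ideal_gen S : S `<=` ideal_gen S.
Proof. by move=> x Sx T [_]; apply. Qed.

Lemma ideal_gen_min S I : is_ideal I -> S `<=` I -> ideal_gen S `<=` I.
Proof. by move=> idI SI x; apply. Qed.

Lemma ideal_mul_ideal I J : is_ideal (ideal_mul I J).
Proof. exact: ideal_gen_ideal. Qed.

Lemma ideal_exp_ideal I m : is_ideal (ideal_exp I m).
Proof. by case: m => [|m] //; apply: ideal_mul_ideal. Qed.

Lemma is_idealD I a b : is_ideal I -> I a -> I b -> I (a + b).
Proof. by case=> _ + _; apply. Qed.

Lemma is_idealMl I a b : is_ideal I -> I b -> I (a * b).
Proof. by case=> _ _; apply. Qed.

Lemma is_idealMr I a b : is_ideal I -> I a -> I (a * b).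
Proof. by rewrite mulrC; apply: is_idealMl. Qed.

Lemma is_idealN I a : is_ideal I -> I a -> I (- a).
Proof. by move=> idI Ia; rewrite -mulN1r; apply: is_idealMl. Qed.

Lemma is_idealB I a b : is_ideal I -> I a -> I b -> I (a - b).
Proof. by move=> idI Ia Ib; apply: is_idealD => //; apply: is_idealN. Qed.

Lemma ideal_sum I (T : Type) (r : seq T) (P : pred T) (F : T -> R) :
  is_ideal I -> (forall i, P i -> I (F i)) -> I (\sum_(i <- r | P i) F i).
Proof.
move=> idI IF; elim/big_ind: _ => [|x y|i Pi]; [by case: idI| |exact: IF].
exact: is_idealD.
Qed.

Lemma bigcap_ideal (T : Type) (P : set T) (F : T -> set R) :
  (forall i, P i -> is_ideal (F i)) -> is_ideal (\bigcap_(i in P) F i).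
Proof.
move=> idF; split=> [i /idF[]//|a b Fa Fb i Pi|a b Fb i Pi].
  by apply: is_idealD; [apply: idF|apply: Fa|apply: Fb].
by apply: is_idealMl; [apply: idF|apply: Fb].
Qed.

Lemma setI_ideal I J : is_ideal I -> is_ideal J -> is_ideal (I `&` J).
Proof.
move=> idI idJ; split=> [|a b [? ?] [? ?]|a b [? ?]].
- by split; [case: idI|case: idJ].
- by split; apply: is_idealD.
- by split; apply: is_idealMl.
Qed.

Lemma colon_ideal x I : is_ideal I -> is_ideal [set c | I (x * c)].
Proof.
move=> idI; split=> [|a b /= Ia Ib|a b /= Ib] /=.
- by rewrite mulr0; case: idI.
- by rewrite mulrDr; apply: is_idealD.
- by rewrite mulrCA; apply: is_idealMl.
Qed.

Lemma mem_ideal_mul I J a b : I a -> J b -> ideal_mul I J (a * b).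
Proof. by move=> Ia Jb; apply: sub_ideal_gen; exists a, b. Qed.

Lemma ideal_mul_min I J K : is_ideal K ->
  (forall a b, I a -> J b -> K (a * b)) -> ideal_mul I J `<=` K.
Proof. by move=> idK sub; apply: ideal_gen_min => // c [a [b [? ? ->]]];
  apply: sub. Qed.

(* The fixed multiplier [x] lets one treat products of several ideals
   elementwise. *)
Lemma ideal_mul_colon x I J K : is_ideal K ->
  (forall a b, I a -> J b -> K (x * (a * b))) ->
  forall c, ideal_mul I J c -> K (x * c).
Proof.
by move=> idK sub c; apply: (@ideal_mul_min _ _ [set c | K (x * c)]) => //;
  apply: colon_ideal.
Qed.

Lemma ideal_mulS I I' J J' : I `<=` I' -> J `<=` J' ->
  ideal_mul I J `<=` ideal_mul I' J'.
Proof.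
move=> sI sJ; apply: ideal_mul_min => [|a b Ia Jb]; first exact: ideal_mul_ideal.
by apply: mem_ideal_mul; [apply: sI|apply: sJ].
Qed.

Lemma ideal_expS I J m : I `<=` J -> ideal_exp I m `<=` ideal_exp J m.
Proof. by move=> IJ; elim: m => [|m IHm] //=; apply: ideal_mulS. Qed.

Lemma ideal_mul_subl I J : is_ideal I -> ideal_mul I J `<=` I.
Proof. by move=> idI; apply: ideal_mul_min => // a b Ia _; apply: is_idealMr. Qed.

Lemma ideal_mul_subr I J : is_ideal J -> ideal_mul I J `<=` J.
Proof. by move=> idJ; apply: ideal_mul_min => // a b _ Jb; apply: is_idealMl. Qed.

Lemma ideal_exp1 I : is_ideal I -> ideal_exp I 1 = I.
Proof.
move=> idI; apply/seteqP; split; first exact: ideal_mul_subl.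
by move=> x Ix; rewrite -[x]mulr1; apply: mem_ideal_mul.
Qed.

Lemma ideal_exp_mem I m a : I a -> ideal_exp I m (a ^+ m).
Proof. by move=> Ia; elim: m => [|m IHm] //; rewrite exprS;
  apply: mem_ideal_mul. Qed.

Lemma ideal_expD I m p a b :
  ideal_exp I m a -> ideal_exp I p b -> ideal_exp I (m + p) (a * b).
Proof.
elim: m a => [|m IHm] a Ia Ib; first by apply: is_idealMl => //;
  apply: ideal_exp_ideal.
rewrite mulrC; move: a Ia; apply: ideal_mul_colon; first exact: ideal_exp_ideal.
move=> a a' Ia Ia'; rewrite mulrC -mulrA; apply: mem_ideal_mul => //.
exact: IHm.
Qed.

Lemma ideal_exp_split I m p :
  ideal_exp I (m + p) `<=` ideal_mul (ideal_exp I m) (ideal_exp I p).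
Proof.
elim: m => [|m IHm] x.
  by move=> Ix; rewrite -[x]mul1r; apply: mem_ideal_mul.
move: x; apply: ideal_mul_min => [|a b Ia Ib]; first exact: ideal_mul_ideal.
move: (IHm _ Ib); move: {Ib} b; apply: ideal_mul_colon => [|b c Ib Ic].
  exact: ideal_mul_ideal.
by rewrite mulrA; apply: mem_ideal_mul => //; apply: mem_ideal_mul.
Qed.

Lemma ideal_exp_le I m p : (p <= m)%N -> ideal_exp I m `<=` ideal_exp I p.
Proof.
move=> /subnK <- x /ideal_exp_split; apply: ideal_mul_subr.
exact: ideal_exp_ideal.
Qed.

Lemma ideal_exp_exp I m p : ideal_exp (ideal_exp I m) p `<=` ideal_exp I (p * m).
Proof.
elim: p => [|p IHp] //; rewrite mulSn /=; apply: ideal_mul_min.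
  exact: ideal_exp_ideal.
by move=> a b Ia /IHp; apply: ideal_expD.
Qed.

Lemma ideal_exp_bigprod I (T : Type) (r : seq T)
    (P : pred T) (d : T -> nat) (F : T -> R) :
  (forall i, P i -> ideal_exp I (d i) (F i)) ->
  ideal_exp I (\sum_(i <- r | P i) d i) (\prod_(i <- r | P i) F i).
Proof.
move=> FI; elim/big_rec2: _ => [|i e x Pi] //.
by apply: ideal_expD; apply: FI.
Qed.

(** The witness is the summand in [I], so that membership reads as a congruence modulo [J]. *)
Definition ideal_add I J : set R := [set f | exists2 g, I g & J (f - g)].

Lemma ideal_add_ideal I J : is_ideal I -> is_ideal J -> is_ideal (ideal_add I J).
Proof.
move=> idI idJ; split.
- by exists 0; rewrite ?subr0; [case: idI|case: idJ].
- move=> a b [g Ig Ja] [h Ih Jb]; exists (g + h); first exact: is_idealD.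
  by rewrite opprD addrACA; apply: is_idealD.
- move=> a b [g Ig Jb]; exists (a * g); first exact: is_idealMl.
  by rewrite -mulrBr; apply: is_idealMl.
Qed.

Lemma sub_addl I J : is_ideal J -> I `<=` ideal_add I J.
Proof. by case=> J0 _ _ f If; exists f; rewrite ?subrr. Qed.

Lemma sub_addr I J : is_ideal I -> J `<=` ideal_add I J.
Proof. by case=> I0 _ _ f Jf; exists 0; rewrite ?subr0. Qed.

Lemma ideal_add_min I J K : is_ideal K -> I `<=` K -> J `<=` K ->
  ideal_add I J `<=` K.
Proof.
by move=> idK IK JK f [g /IK Ig /JK Jg]; rewrite -(subrK g f); apply: is_idealD.
Qed.

Lemma ideal_addS I I' J J' : I `<=` I' -> J `<=` J' ->
  ideal_add I J `<=` ideal_add I' J'.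
Proof. by move=> sI sJ f [g /sI ? /sJ ?]; exists g. Qed.

Lemma ideal_exp_add I J m : is_ideal I -> is_ideal J ->
  ideal_exp (ideal_add I J) m `<=` ideal_add (ideal_exp I m) J.
Proof.
move=> idI idJ; elim: m => [|m IHm] /=.
  by move=> f _; apply: sub_addl.
have idK : is_ideal (ideal_add (ideal_mul I (ideal_exp I m)) J).
  by apply: ideal_add_ideal => //; apply: ideal_mul_ideal.
apply: ideal_mul_min => // a b [g Ig Ja] /IHm[h Ih Jb].
exists (g * h); first exact: mem_ideal_mul.
have -> : a * b - g * h = (a - g) * b + g * (b - h) by ring.
by apply: is_idealD => //; [apply: is_idealMr|apply: is_idealMl].
Qed.

Lemma sub_ideal_exp_exp I m p :
  ideal_exp I (p * m) `<=` ideal_exp (ideal_exp I m) p.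
Proof.
elim: p => [|p IHp] //=; rewrite mulSn => x /ideal_exp_split; move: x.
exact: ideal_mulS.
Qed.

Lemma ideal_mul_addr I J K : is_ideal K ->
  ideal_mul I (ideal_add J K) `<=` ideal_add (ideal_mul I J) K.
Proof.
move=> idK; apply: ideal_mul_min => [|a b Ia [c Jc Kbc]].
  by apply: ideal_add_ideal => //; apply: ideal_mul_ideal.
by exists (a * c); [apply: mem_ideal_mul|rewrite -mulrBr; apply: is_idealMl].
Qed.

(** This is the sum of [I] and (x), in a form from which [ideal_gen_min] extracts the quotient g. *)
Lemma congr_principal_ideal I x : is_ideal I ->
  is_ideal [set f | exists g, I (f - x * g)].
Proof.
move=> idI; split.
- by exists 0; rewrite mulr0 subr0; case: idI.
- move=> f1 f2 [g1 T1] [g2 T2]; exists (g1 + g2).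
  by rewrite mulrDr opprD addrACA; apply: is_idealD.
- move=> f1 f2 [g T2]; exists (f1 * g).
  by rewrite mulrCA -mulrBr; apply: is_idealMl.
Qed.

End IdealTheory.

(** * Linear coordinates *)

Lemma linear_formE (k : fieldType) (n : nat) (f : {mpoly k[n.+1]}) :
  linear_form f -> f = \sum_i f@_U_(i) *: 'X_i.
Proof.
move=> f1; apply/mpolyP => m; rewrite raddf_sum /=.
have [/mdeg1P[i /eqP ->]|m1] := boolP (mdeg m == 1%N).
  rewrite (bigD1 i) //= mcoeffZ mcoeffXU eqxx mulr1 big1 ?addr0 // => j /negPf ji.
  by rewrite mcoeffZ mcoeffXU ji mulr0.
rewrite (dhomog_nemf_coeff f1 m1) big1 // => i _.
rewrite mcoeffZ mcoeffX; case: eqVneq => [im|]; last by rewrite mulr0.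
by rewrite -im mdeg1 eqxx in m1.
Qed.

Lemma dhomog_bigprod (k : fieldType) (n : nat) (T : Type) (r : seq T)
    (P : pred T) (d : T -> nat) (F : T -> {mpoly k[n]}) :
  (forall i, P i -> F i \is (d i).-homog) ->
  \prod_(i <- r | P i) F i \is (\sum_(i <- r | P i) d i).-homog.
Proof.
move=> Fd; elim/big_rec2: _ => [|i e x Pi]; first exact: dhomog1.
by apply: dhomogM; apply: Fd.
Qed.

Section Coordinates.
Context (k : fieldType) (n v : nat) (l : 'I_v -> {mpoly k[n.+1]}).
Local Notation R := {mpoly k[n.+1]}.

Hypothesis l_linear : forall j, linear_form (l j).
Hypothesis H_meet_n1 : forall s : {set 'I_v}, #|s| = n.+1 ->
  ~ exists p : proj_space k n, forall j, j \in s -> hyperplane (l j) p.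

Section Basis.
Context (a : 'I_n.+1 -> 'I_v) (a_inj : injective a).

Let B : 'M[k]_n.+1 := \matrix_(i, j) (l (a i))@_U_(j).

(** A nonzero vector killed by n + 1 of the forms spans a line, hence gives a point common to n + 1
    hyperplanes. *)
Lemma form_matrix_unit : B \in unitmx.
Proof.
rewrite -unitmx_tr -row_free_unit -kermx_eq0; apply/negP => /negP kerB.
have [u uB u0] := rowV0Pn kerB; move/sub_kermxP in uB.
apply: (@H_meet_n1 (a @: [set: 'I_n.+1]%SET)).
  by rewrite card_imset // cardsT card_ord.
have du : \dim <[u]>%VS == 1%N by rewrite dim_vline u0.
exists (exist _ <[u]>%VS du) => _ /imsetP[i _ ->] w /vlineP[c ->].
rewrite (linear_formE (l_linear (a i))) raddf_sum /=.
have := congr1 (fun M : 'rV[k]_n.+1 => c * M 0 i) uB; rewrite !mxE mulr0.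
apply: etrans; rewrite mulr_sumr; apply: eq_bigr => j _.
by rewrite mevalZ mevalXU !mxE; ring.
Qed.

(** [phi] substitutes the forms for the variables and [psi] the rows of the inverse matrix; those
    rows are linear, so [psi] preserves degrees. *)
Lemma coordinates : exists phi psi : {rmorphism R -> R},
  [/\ forall i, phi 'X_i = l (a i), forall i, psi (l (a i)) = 'X_i,
      cancel psi phi, forall c, phi c%:MP = c%:MP
    & forall d p, p \is d.-homog -> psi p \is d.-homog].
Proof.
pose C := invmx B.
pose sphi := [tuple l (a i) | i < n.+1].
pose spsi := [tuple \sum_j C i j *: ('X_j : R) | i < n.+1].
exists (comp_mpoly sphi), (comp_mpoly spsi).
have phiX i : comp_mpoly sphi 'X_i = l (a i).
  by rewrite comp_mpolyXU -tnth_nth tnth_mktuple.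
have psiX i : comp_mpoly spsi 'X_i = \sum_j C i j *: ('X_j : R).
  by rewrite comp_mpolyXU -tnth_nth tnth_mktuple.
(* Composing linear substitutions multiplies their matrices. *)
have comb (D E : 'M[k]_n.+1) (y z : 'I_n.+1 -> R) :
    (forall i, y i = \sum_j E i j *: z j) ->
    forall i, \sum_j D i j *: y j = \sum_j (D *m E) i j *: z j.
  move=> yz i; under eq_bigr => j _ do rewrite yz scaler_sumr.
  rewrite exchange_big /=; apply: eq_bigr => m _; rewrite mxE scaler_suml.
  by apply: eq_bigr => j _; rewrite scalerA.
have one (z : 'I_n.+1 -> R) i : \sum_j (1%:M : 'M[k]_n.+1) i j *: z j = z i.
  rewrite (bigD1 i) //= mxE eqxx scale1r big1 ?addr0 // => j /negPf ji.
  by rewrite mxE eq_sym ji scale0r.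
have laE i : l (a i) = \sum_j B i j *: ('X_j : R).
  rewrite {1}(linear_formE (l_linear (a i))); apply: eq_bigr => j _.
  by rewrite mxE.
have phipsiX i : comp_mpoly sphi (comp_mpoly spsi 'X_i) = 'X_i.
  rewrite psiX raddf_sum /=; under eq_bigr => j _ do rewrite comp_mpolyZ phiX.
  by rewrite (comb _ _ _ _ laE) mulVmx ?form_matrix_unit // one.
split=> //.
- move=> i; rewrite laE raddf_sum /=.
  under eq_bigr => j _ do rewrite comp_mpolyZ.
  by rewrite (comb _ _ _ _ psiX) mulmxV ?form_matrix_unit // one.
- move=> p /=; rewrite [RHS]mpolyE [comp_mpoly spsi p]comp_mpolyEX raddf_sum /=.
  apply: eq_bigr => m _; rewrite comp_mpolyZ; congr (_ *: _).
  rewrite mpolyXE_id !rmorph_prod /=; apply: eq_bigr => i _.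
  by rewrite !rmorphXn /= phipsiX.
- by move=> c; apply: comp_mpolyC.
- move=> d p pd /=; rewrite comp_mpolyEX big_seq; apply: rpred_sum => m mp.
  apply: rpredZ; rewrite comp_mpolyX -(dhomog_mf pd mp) /= mdegE.
  apply: dhomog_bigprod => i _; rewrite tnth_mktuple.
  have h1 : \sum_j C i j *: ('X_j : R) \is 1.-homog.
    by apply: rpred_sum => j _; apply: rpredZ; rewrite dhomogX /= mdeg1.
  by have := dhomogMn (m i) h1; rewrite mul1n.
Qed.

End Basis.
End Coordinates.

(** * Fat ideals *)

Lemma card_superset_in (T : finType) (S W : {set T}) (m : nat) : S \subset W ->
  (#|S| <= m)%N -> (m <= #|W|)%N ->
  exists A : {set T}, [/\ S \subset A, A \subset W & #|A| = m].
Proof.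
move=> SW Sm; rewrite -(subnK Sm).
elim: (m - #|S|)%N => [|d IHd] dW; first by exists S.
have [|A [SA AW cA]] := IHd; first by apply: ltnW.
have /subsetPn[x xW xA] : ~~ (W \subset A).
  by apply: contraL dW => /subset_leq_card; rewrite cA -ltnNge ltnS.
exists (x |: A); split; last by rewrite cardsU1 xA cA.
  exact: fintype.subset_trans SA (finset.subsetUr _ _).
by rewrite finset.subUset finset.sub1set xW.
Qed.

Lemma card_superset (T : finType) (S : {set T}) (m : nat) :
  (#|S| <= m)%N -> (m <= #|T|)%N -> exists2 A : {set T}, S \subset A & #|A| = m.
Proof.
move=> Sm; rewrite -cardsT => mT.
by have [A [SA _ cA]] := card_superset_in (finset.subsetT S) Sm mT; exists A.
Qed.

Section FatIdeals.
Context (k : fieldType) (n v : nat) (l : 'I_v -> {mpoly k[n.+1]}).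
Local Notation R := {mpoly k[n.+1]}.
Implicit Types (S T A : {set 'I_v}) (f g : R) (m d : nat) (j : 'I_v).

Hypothesis n_lt_v : (n < v)%N.
Hypothesis l_linear : forall j, linear_form (l j).
Hypothesis H_meet_n1 : forall s : {set 'I_v}, #|s| = n.+1 ->
  ~ exists p : proj_space k n, forall j, j \in s -> hyperplane (l j) p.

(* Vanishing to order m along S, on the linear space cut out by T. *)
Definition fat S m T : set R :=
  ideal_add (ideal_exp (point_ideal l S) m) (point_ideal l T).

Lemma point_ideal_ideal S : is_ideal (point_ideal l S).
Proof. exact: ideal_gen_ideal. Qed.

Lemma point_ideal_form S j : j \in S -> point_ideal l S (l j).
Proof. by move=> jS; apply: sub_ideal_gen; exists j. Qed.

Lemma point_idealS S T : S \subset T -> point_ideal l S `<=` point_ideal l T.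
Proof.
move=> ST; apply: ideal_gen_min => [|f [j jS ->]]; first exact: point_ideal_ideal.
by apply: point_ideal_form; apply: (fintype.subsetP ST).
Qed.

Lemma fat_ideal S m T : is_ideal (fat S m T).
Proof. by apply: ideal_add_ideal;
  [apply: ideal_exp_ideal|apply: point_ideal_ideal]. Qed.

(** Membership in [point_ideal] thus becomes the case m = 1 of the results on fat ideals. *)
Lemma fat1 S T : T \subset S -> fat S 1 T = point_ideal l S.
Proof.
move=> TS; have idS := point_ideal_ideal S.
rewrite /fat ideal_exp1 //; apply/seteqP; split.
  by apply: ideal_add_min => //; apply: point_idealS.
by apply: sub_addl; apply: point_ideal_ideal.
Qed.

Section Monomials.
Context (a : 'I_n.+1 -> 'I_v) (a_inj : injective a).
Context (phi psi : {rmorphism R -> R}).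
Hypothesis phiX : forall i, phi 'X_i = l (a i).
Hypothesis psil : forall i, psi (l (a i)) = 'X_i.
Hypothesis psiK : cancel psi phi.
Hypothesis phiC : forall c, phi c%:MP = c%:MP.

(** The order of vanishing along [S] of a monomial in the coordinates [a]. *)
Definition weight S (u : 'X_{1..n.+1}) := (\sum_(i | a i \in S) u i)%N.

Definition fat_monomials S m T (p : R) := forall u, u \in msupp p ->
  (m <= weight S u)%N \/ exists2 i, a i \in T & (0 < u i)%N.

Lemma weightD S u1 u2 : weight S (u1 + u2)%MM = (weight S u1 + weight S u2)%N.
Proof. by rewrite -big_split; apply: eq_bigr => i _; rewrite mnmDE. Qed.

Lemma weightU S i : weight S U_(i)%MM = (a i \in S).
Proof.
rewrite /weight; have [iS|iS] := boolP (a i \in S).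
  rewrite (bigD1 i) //= mnm1E eqxx big1 // => j /andP[_ /negPf ji].
  by rewrite mnm1E eq_sym ji.
rewrite big1 // => j jS; rewrite mnm1E; case: eqVneq => // ij.
by rewrite ij jS in iS.
Qed.

Lemma fat_monomialsM S m1 m2 T p q : fat_monomials S m1 T p ->
  fat_monomials S m2 T q -> fat_monomials S (m1 + m2) T (p * q).
Proof.
move=> mp mq u /msuppM_le/allpairsP[[u1 u2] /= [u1p u2q ->]].
have [w1|[i iT ui]] := mp _ u1p; last first.
  by right; exists i; rewrite // mnmDE; lia.
have [w2|[i iT ui]] := mq _ u2q; last first.
  by right; exists i; rewrite // mnmDE; lia.
by left; rewrite weightD; lia.
Qed.

Lemma fat_monomials_ideal S m T : is_ideal [set f | fat_monomials S m T (psi f)].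
Proof.
split=> [|f g /= mf mg u|f g /= mg].
- by move=> u /=; rewrite rmorph0 msupp0.
- by rewrite rmorphD => /msuppD_le; rewrite mem_cat => /orP[/mf|/mg].
- rewrite rmorphM -[m]add0n; apply: fat_monomialsM => // u _.
  by left.
Qed.

(** The condition on monomials defines an ideal containing the generators; conversely [f] is the
    image under [phi] of the expansion of [psi f], and [phi] sends each allowed monomial into the
    fat ideal. *)
Lemma fat_monomialsP S m T f :
  (forall j, j \in S :|: T -> exists i, a i = j) ->
  fat S m T f <-> fat_monomials S m T (psi f).
Proof.
move=> aST; split.
  move: f; apply: ideal_add_min; first exact: fat_monomials_ideal.
    elim: m => [|m IHm]; first by move=> f _ u _; left.
    apply: ideal_mul_min; first exact: fat_monomials_ideal.
    move=> f g fS /IHm mg /=; rewrite rmorphM -[m.+1]add1n.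
    apply: fat_monomialsM => //; move: f fS.
    apply: ideal_gen_min; first exact: fat_monomials_ideal.
    move=> f [j jS ->] /=; have [|i ij] := aST j; first by rewrite inE jS.
    rewrite -ij psil => u; rewrite msuppX inE => /eqP ->; left.
    by rewrite weightU ij jS.
  apply: ideal_gen_min; first exact: fat_monomials_ideal.
  move=> f [j jT ->] /=; have [|i ij] := aST j; first by rewrite inE jT orbT.
  rewrite -ij psil => u; rewrite msuppX inE => /eqP ->; right.
  by exists i; rewrite ?ij // mnm1E eqxx.
move=> mf; rewrite -(psiK f) (mpolyE (psi f)) raddf_sum /= big_seq.
apply: ideal_sum => [|u uf]; first exact: fat_ideal.
rewrite -mul_mpolyC rmorphM; apply: is_idealMl; first exact: fat_ideal.
rewrite mpolyXE_id rmorph_prod.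
under eq_bigr => i _ do rewrite rmorphXn phiX.
have [mu|[i iT ui]] := mf _ uf.
  apply: sub_addl; first exact: point_ideal_ideal.
  rewrite (bigID (fun i => a i \in S)) /=.
  rewrite mulrC; apply: is_idealMl; first exact: ideal_exp_ideal.
  apply: (ideal_exp_le mu); apply: ideal_exp_bigprod => i iS.
  by apply: ideal_exp_mem; apply: point_ideal_form.
apply: sub_addr; first exact: ideal_exp_ideal.
rewrite (bigD1 i) //= mulrC; apply: (@is_idealMl _ (point_ideal l T));
  first exact: point_ideal_ideal.
rewrite -(prednK ui) exprS mulrC; apply: (@is_idealMl _ (point_ideal l T));
  first exact: point_ideal_ideal.
exact: point_ideal_form.
Qed.

Lemma fat_monomials_colon_in S m T i p : a i \notin T ->
  fat_monomials S m T ('X_i * p) -> fat_monomials S (m - (a i \in S)) T p.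
Proof.
move=> iT mp u up; have : (U_(i) + u)%MM \in msupp ('X_i * p).
  by rewrite mcoeff_msupp mulrC mcoeffMX -mcoeff_msupp.
case/mp => [|[i' i'T]]; first by rewrite weightD weightU; left; lia.
rewrite mnmDE mnm1E; case: eqVneq => [ii'|_ ui']; first by rewrite ii' i'T in iT.
by right; exists i'.
Qed.

Lemma fat_monomials_sub S m T p q : {subset msupp q <= msupp p} ->
  fat_monomials S m T p -> fat_monomials S m T q.
Proof. by move=> qp mp u /qp; apply: mp. Qed.

End Monomials.

Lemma set_coordinates A : #|A| = n.+1 -> exists2 a : 'I_n.+1 -> 'I_v,
  injective a & forall j, (j \in A) = [exists i, a i == j].
Proof.
move=> cA; pose a (i : 'I_n.+1) := enum_val (cast_ord (esym cA) i).
exists a => [i i' /enum_val_inj/cast_ord_inj //|j].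
apply/idP/existsP => [jA|[i /eqP <-]]; last exact: enum_valP.
exists (cast_ord cA (enum_rank_in jA j)).
by rewrite /a cast_ordK enum_rankK_in.
Qed.

(* Membership in a fat ideal is a condition on monomials, in coordinates in
   which the forms indexed by S and T are variables. *)
Lemma fat_coordinates S T : (#|S :|: T| <= n.+1)%N ->
  exists (a : 'I_n.+1 -> 'I_v) (phi psi : {rmorphism R -> R}),
  [/\ injective a, cancel psi phi,
      forall i, phi 'X_i = l (a i) /\ psi (l (a i)) = 'X_i,
      forall d p, p \is d.-homog -> psi p \is d.-homog
    & [/\ forall c, phi c%:MP = c%:MP,
          forall j, j \in S :|: T -> exists i, a i = j
        & forall S' m T' f, S' :|: T' \subset S :|: T ->
            fat S' m T' f <-> fat_monomials a S' m T' (psi f)]].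
Proof.
move=> cST; have [|A STA cA] := card_superset cST; first by rewrite card_ord.
have [a a_inj aA] := set_coordinates cA.
have [phi [psi [phiX psil psiK phiC psih]]] := coordinates l_linear H_meet_n1 a_inj.
exists a, phi, psi; split=> //; split=> //.
  by move=> j /(fintype.subsetP STA); rewrite aA => /existsP[i /eqP]; exists i.
move=> S' m T' f sub; apply: fat_monomialsP => //.
by move=> j /(fintype.subsetP sub)/(fintype.subsetP STA);
  rewrite aA => /existsP[i /eqP]; exists i.
Qed.

(** The bound on the cardinal allows coordinates in which [l j] too is a variable. Dividing by it
    lowers one exponent, and since j is outside [T], divisibility by a variable of [T] is kept. *)
Lemma fat_colon S m T j f : j \notin T -> (#|j |: (S :|: T)| <= n.+1)%N ->
  fat S m T (l j * f) -> fat S (m - (j \in S)) T f.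
Proof.
move=> jT cS; have [|a [phi [psi [a_inj psiK phil _ [_ aST fatP]]]]] :=
  @fat_coordinates (j |: S) T.
  by rewrite -finset.setUA.
have sub : S :|: T \subset (j |: S) :|: T by rewrite -finset.setUA finset.subsetUr.
have [|i ij] := aST j; first by rewrite !inE eqxx.
rewrite !fatP // rmorphM -ij (phil i).2.
by apply: fat_monomials_colon_in; rewrite ?ij.
Qed.

End FatIdeals.

(** * Homogeneous components *)

Section GradedPieces.
Context (k : fieldType) (n : nat).
Implicit Types (p q : {mpoly k[n]}) (d e : nat).

Lemma msupp_pihomog d p : {subset msupp (pihomog mdeg d p) <= msupp p}.
Proof.
move=> u; rewrite !mcoeff_msupp; apply: contraNneq => pu.
have [ud|ud] := eqVneq (mdeg u) d; last first.
  by rewrite (dhomog_nemf_coeff (pihomogP _ d p)).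
rewrite raddf_sum /= big1_seq // => u' /andP[_ u'p].
rewrite mcoeffZ mcoeffX; case: eqVneq => [->|]; last by rewrite mulr0.
by rewrite pu mul0r.
Qed.

Lemma pihomog_morph (psi : {rmorphism {mpoly k[n]} -> {mpoly k[n]}}) d p :
  (forall e q, q \is e.-homog -> psi q \is e.-homog) ->
  psi (pihomog mdeg d p) = pihomog mdeg d (psi p).
Proof.
(* [K] exceeds d even when [p] has smaller degree, so that d is an index of the decomposition. *)
move=> psih; pose K := maxn (msize p) d.+1.
rewrite [in RHS](@pihomog_partitionE _ _ mdeg K p) ?leq_maxl //.
rewrite [psi (\sum_(i < K) _)]raddf_sum [RHS]raddf_sum.
rewrite (bigD1 (Ordinal (leq_maxr (msize p) d.+1))) //=.
rewrite [pihomog _ _ (psi _)]pihomog_dE ?psih ?pihomogP // [X in _ + X]big1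
  ?addr0 // => i ni.
rewrite (pihomog_ne0 (d := i)) ?psih ?pihomogP //.
Qed.

Lemma pihomogMl d e p q : p \is e.-homog ->
  pihomog mdeg (e + d) (p * q) = p * pihomog mdeg d q.
Proof.
move=> pe; pose K := maxn (msize q) d.+1.
rewrite [in LHS](@pihomog_partitionE _ _ mdeg K q) ?leq_maxl //.
rewrite mulr_sumr raddf_sum /= (bigD1 (Ordinal (leq_maxr (msize q) d.+1))) //=.
rewrite [pihomog _ _ (_ * _)]pihomog_dE ?[X in _ + X]big1 ?addr0 //;
  last by apply: dhomogM => //; apply: pihomogP.
move=> i ni; rewrite (pihomog_ne0 (d := (e + i)%N)) //.
  by apply: contraNneq ni => id; apply/eqP/val_inj => /=; lia.
by apply: dhomogM => //; apply: pihomogP.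
Qed.

Lemma pihomogMl_small d e p q : p \is e.-homog -> (d < e)%N ->
  pihomog mdeg d (p * q) = 0.
Proof.
move=> pe de; rewrite (@pihomog_partitionE _ _ mdeg (msize q) q) //.
rewrite mulr_sumr raddf_sum big1 //= => i _.
rewrite (pihomog_ne0 (d := (e + i)%N)) //; first by apply/eqP; lia.
by apply: dhomogM => //; apply: pihomogP.
Qed.

End GradedPieces.

(** * Ideals of linear subspaces: primality and division by the forms *)

Section PointIdeals.
Context (k : fieldType) (n v : nat) (l : 'I_v -> {mpoly k[n.+1]}).
Local Notation R := {mpoly k[n.+1]}.
Local Notation fat := (fat l).
Local Notation M := (irrelevant_ideal k n).
Implicit Types (S T A : {set 'I_v}) (f g : R) (m d : nat) (j : 'I_v).

Hypothesis n_lt_v : (n < v)%N.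
Hypothesis l_linear : forall j, linear_form (l j).
Hypothesis H_meet_n1 : forall s : {set 'I_v}, #|s| = n.+1 ->
  ~ exists p : proj_space k n, forall j, j \in s -> hyperplane (l j) p.

Lemma irrelevant_ideal_ideal : is_ideal M.
Proof. exact: ideal_gen_ideal. Qed.

Lemma irrelevant_form f : linear_form f -> M f.
Proof.
move=> /linear_formE ->; apply: ideal_sum => [|i _];
  first exact: irrelevant_ideal_ideal.
rewrite -mul_mpolyC; apply: (@is_idealMl _ M); first exact: irrelevant_ideal_ideal.
by apply: sub_ideal_gen; exists i.
Qed.

Lemma set_coordinates_weight A (a : 'I_n.+1 -> 'I_v) u : injective a ->
  #|A| = n.+1 -> (forall j, j \in A -> exists i, a i = j) ->
  weight a A u = mdeg u.
Proof.
move=> a_inj cA aA; rewrite mdegE /weight; apply: eq_bigl => i; apply/idP.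
have sub : A \subset (a @: 'I_n.+1).
  by apply/fintype.subsetP => j /aA[i' <-]; apply: imset_f.
have /eqP -> : A == (a @: 'I_n.+1).
  by rewrite eqEcard sub card_imset // card_ord cA leqnn.
exact: imset_f.
Qed.

(** Powers of [M] become fat ideals, to which colon computations apply. *)
Lemma irrelevantE A : #|A| = n.+1 -> M = point_ideal l A.
Proof.
move=> cA; apply/seteqP; split; last first.
  apply: ideal_gen_min => [|f [j _ ->]]; first exact: irrelevant_ideal_ideal.
  exact: irrelevant_form.
apply: ideal_gen_min => [|_ [i ->]]; first exact: point_ideal_ideal.
have [|a [phi [psi [a_inj psiK phil psih [_ aA fatP]]]]] :=
    @fat_coordinates _ _ _ l n_lt_v l_linear H_meet_n1 A A.
  by rewrite finset.setUid cA.
rewrite -(fat1 l (fintype.subxx A)) fatP // => u uX; left.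
rewrite (set_coordinates_weight _ a_inj cA) => [|j jA]; last first.
  by apply: aA; rewrite finset.setUid.
by rewrite (dhomog_mf (psih 1%N _ _) uX) // dhomogX /= mdeg1.
Qed.

(** In coordinates, passing to a homogeneous component only discards monomials. *)
Lemma fat_homog S m T d f : (#|S :|: T| <= n.+1)%N ->
  fat S m T f -> fat S m T (pihomog mdeg d f).
Proof.
move=> cST; have [a [phi [psi [a_inj psiK phil psih [_ aA fatP]]]]] :=
    fat_coordinates n_lt_v l_linear H_meet_n1 cST.
rewrite !fatP // pihomog_morph //.
exact/fat_monomials_sub/msupp_pihomog.
Qed.

(* Killing the forms indexed by S is a ring endomorphism, hence the kernel is
   prime. *)
Lemma point_ideal_reduction S : (#|S| <= n.+1)%N ->
  exists r : {rmorphism R -> R},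
    forall f, point_ideal l S f <-> r f = 0.
Proof.
move=> cS; have [|a [phi [psi [a_inj psiK phil psih [phiC aA fatP]]]]] :=
    @fat_coordinates _ _ _ l n_lt_v l_linear H_meet_n1 S S.
  by rewrite finset.setUid.
pose th := [tuple (if a i \in S then 0 else 'X_i : R) | i < n.+1].
pose r : {rmorphism R -> R} := comp_mpoly th \o psi.
have thX i : comp_mpoly th 'X_i = if a i \in S then 0 else 'X_i.
  by rewrite comp_mpolyXU -tnth_nth tnth_mktuple.
exists r => f; split.
  move: f; apply: (@ideal_gen_min _ _ [set f | r f = 0]).
    split=> [|f g rf rg|f g rg].
    - exact: rmorph0.
    - by apply: etrans (rmorphD r f g) _; rewrite rf rg addr0.
    - by apply: etrans (rmorphM r f g) _; rewrite rg mulr0.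
  move=> f [j jS ->]; have [|i ij] := aA j; first by rewrite inE jS.
  by rewrite /= -ij (phil i).2 thX ij jS.
(* [K] holds the polynomials that the reduction changes only by an element of the ideal. It contains
   constants and variables and is stable under sums and products, so it is everything. *)
pose K := [set p | point_ideal l S (phi p - phi (comp_mpoly th p))].
have idS := point_ideal_ideal l S.
have KM p q : K p -> K q -> K (p * q).
  move=> Kp Kq; rewrite /K /= !rmorphM /=.
  set p' := phi (comp_mpoly th p); set q' := phi (comp_mpoly th q).
  have -> : phi p * phi q - p' * q' = (phi p - p') * phi q + p' * (phi q - q').
    by ring.
  by apply: (@is_idealD _ (point_ideal l _)) => //;
    [apply: (@is_idealMr _ (point_ideal l _))|apply: (@is_idealMl _
      (point_ideal l _))].
have KC c : K c%:MP.
  by rewrite /K /= comp_mpolyC subrr; case: idS.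
have KX i : K 'X_i.
  rewrite /K /= thX; case: ifP => iS; last by rewrite subrr; case: idS.
  by rewrite rmorph0 subr0 (phil i).1; apply: point_ideal_form.
have Kall p : K p.
  rewrite (mpolyE p); elim/big_rec: _ => [|u q _ Kq].
    by rewrite -mpolyC0.
  rewrite /K /= !rmorphD opprD addrACA;
    apply: (@is_idealD _ (point_ideal l _)) => //.
  rewrite -mul_mpolyC; apply: (KM _ _) => //; rewrite mpolyXE_id.
  elim/big_rec: _ => [|i q' _ Kq']; first by rewrite -mpolyC1.
  apply: (KM _ _) => //; elim: (u i) => [|e IHe]; first by rewrite expr0 -mpolyC1.
  by rewrite exprS; apply: (KM _ _).
by move=> /= rf; have := Kall (psi f); rewrite /K /= rf rmorph0 subr0 psiK.
Qed.

Lemma point_ideal_prime S : (#|S| <= n.+1)%N -> prime_ideal (point_ideal l S).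
Proof.
move=> /point_ideal_reduction[r rP]; split.
- exact: point_ideal_ideal.
- by rewrite rP rmorph1 => /eqP; rewrite oner_eq0.
- by move=> f g; rewrite !rP rmorphM => /eqP; rewrite mulf_eq0 => /orP[]/eqP; tauto.
Qed.

(** Since [l j] is a nonzerodivisor modulo the ideal, its membership would give that of 1. *)
Lemma point_ideal_formN S j : (#|S| <= n)%N -> j \notin S -> ~ point_ideal l S
  (l j).
Proof.
move=> cS jS lj; have [|_ S1 _] := @point_ideal_prime S; first exact: ltnW.
have := @fat_colon _ _ _ l n_lt_v l_linear H_meet_n1 S 1 finset.set0 j 1.
rewrite (negbTE jS) subn0 mulr1 !fat1 ?finset.sub0set // => S0.
apply: S1; apply: S0 => //; first by rewrite inE.
by rewrite finset.setU0 cardsU1 jS.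
Qed.

Lemma irrelevant_colon T j m f : (#|T| <= n)%N -> j \notin T ->
  ideal_add (ideal_exp M m) (point_ideal l T) (l j * f) ->
  ideal_add (ideal_exp M m.-1) (point_ideal l T) f.
Proof.
move=> cT jT; have [||A jTA cA] := @card_superset _ (j |: T) n.+1.
- by rewrite cardsU1 jT.
- by rewrite card_ord.
have [jA TA] : j \in A /\ T \subset A.
  by move: jTA; rewrite finset.subUset finset.sub1set => /andP.
rewrite (irrelevantE cA) => /(@fat_colon _ _ _ l n_lt_v l_linear H_meet_n1 A m T).
rewrite jA subn1; apply=> //.
by rewrite (finset.setUidPl TA) (finset.setUidPr _) ?finset.sub1set ?cA.
Qed.

Lemma point_ideal_add_form T j f : point_ideal l (j |: T) f ->
  exists g, point_ideal l T (f - l j * g).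
Proof.
move: f; apply: (@ideal_gen_min _ _ [set f | exists g, point_ideal l T (f - l j
  * g)]).
  exact/congr_principal_ideal/point_ideal_ideal.
move=> f [i iS ->]; move: iS; rewrite !inE => /orP[/eqP ->|iT].
  by exists 1; rewrite mulr1 subrr; case: (point_ideal_ideal l T).
by exists 0; rewrite mulr0 subr0; apply: point_ideal_form.
Qed.

Lemma point_ideal_prod (s : seq 'I_v) S : (#|S| <= n)%N ->
  (forall j, j \in s -> j \notin S) -> ~ point_ideal l S (\prod_(j <- s) l j).
Proof.
move=> cS; have [|_ S1 SM] := @point_ideal_prime S; first exact: ltnW.
elim: s => [|j s IHs] sS; first by rewrite big_nil.
rewrite big_cons => /SM[|].
  by apply: point_ideal_formN => //; apply: sS; rewrite mem_head.
by apply: IHs => i si; apply: sS; rewrite inE si orbT.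
Qed.

(* On the linear space cut out by T, of dimension at least one, the forms
   indexed by s are pairwise coprime. *)
Lemma point_ideal_peel T (s : seq 'I_v) f : (#|T| < n)%N -> uniq s ->
  (forall j, j \in s -> j \notin T /\ point_ideal l (j |: T) f) ->
  exists g, point_ideal l T (f - (\prod_(j <- s) l j) * g).
Proof.
move=> cT; elim: s => [|j s IHs] /=.
  by exists f; rewrite big_nil mul1r subrr; case: (point_ideal_ideal l T).
move=> /andP[js us] sT; have [|g Tg] := IHs us.
  by move=> i si; apply: sT; rewrite inE si orbT.
have [jT jf] := sT j (mem_head _ _).
have cjT : (#|j |: T| <= n)%N by rewrite cardsU1 jT.
have [|idj _ jM] := @point_ideal_prime (j |: T); first exact: ltnW.
have /jM[] : point_ideal l (j |: T) ((\prod_(j <- s) l j) * g).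
  have -> : (\prod_(j <- s) l j) * g = f - (f - (\prod_(j <- s) l j) * g) by ring.
  by apply: (@is_idealB _ (point_ideal l _)) => //; apply: point_idealS Tg;
    apply: finset.subsetUr.
  move=> /point_ideal_prod[] // i si; rewrite !inE negb_or.
  have [|-> _] := sT i; first by rewrite inE si orbT.
  by rewrite andbT; apply: contraNneq js => <-.
move=> /point_ideal_add_form[h Th]; exists h; rewrite big_cons.
set P := \prod_(j <- s) l j.
have -> : f - l j * P * h = (f - P * g) + P * (g - l j * h) by ring.
have idT := point_ideal_ideal l T.
by apply: (@is_idealD _ (point_ideal l _)) => //;
  apply: (@is_idealMl _ (point_ideal l _)).
Qed.

Lemma prod_form_homog (s : seq 'I_v) : \prod_(j <- s) l j \is (size s).-homog.
Proof. by rewrite -sum1_size; apply: dhomog_bigprod => j _; apply: l_linear. Qed.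

(** Take the component of degree d in [point_ideal_peel]: if the product has degree above d, its
    multiple disappears and [f] itself is in the ideal. *)
Lemma point_ideal_peel_homog T (s : seq 'I_v) d f : (#|T| < n)%N -> uniq s ->
  f \is d.-homog ->
  (forall j, j \in s -> j \notin T /\ point_ideal l (j |: T) f) ->
  point_ideal l T f \/ exists g, [/\ (size s <= d)%N, g \is (d - size s).-homog
    & point_ideal l T (f - (\prod_(j <- s) l j) * g)].
Proof.
move=> cT us fd /(point_ideal_peel cT us)[g Tg].
have : point_ideal l T (pihomog mdeg d (f - (\prod_(j <- s) l j) * g)).
  have cT' : (#|T :|: T| <= n.+1)%N by rewrite finset.setUid; lia.
  by rewrite -(fat1 l (fintype.subxx T)) in Tg *; apply: fat_homog.
have Ph := prod_form_homog s; rewrite pihomogB (pihomog_dE fd).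
have [ds|sd] := ltnP d (size s);
  first by rewrite (pihomogMl_small _ Ph) // subr0; left.
rewrite -{1}(subnKC sd) pihomogMl // => Tg'; right.
by exists (pihomog mdeg (d - size s) g); split=> //; apply: pihomogP.
Qed.

Lemma fat_colon_prod S m T (s : seq 'I_v) f : (#|S| <= n)%N -> T \subset S ->
  (forall j, j \in s -> j \notin T) ->
  fat S m T ((\prod_(j <- s) l j) * f) -> fat S (m - count (mem S) s) T f.
Proof.
move=> cS TS; elim: s m => [|j s IHs] m sT; first by rewrite big_nil mul1r subn0.
rewrite big_cons -mulrA => /(@fat_colon _ _ _ l n_lt_v l_linear H_meet_n1 S m T).
rewrite /= subnDA => jf; apply: IHs => [i si|].
  by apply: sT; rewrite inE si orbT.
apply: jf; first by apply: sT; rewrite mem_head.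
by rewrite (finset.setUidPl TS) cardsU1; exact: leq_trans (leq_add (leq_b1 _) cS) _.
Qed.

Lemma fat_congr S m T f g : point_ideal l T (f - g) -> fat S m T f -> fat S m T g.
Proof.
move=> Tfg Sf; have -> : g = f - (f - g) by ring.
apply: (@is_idealB _ (fat S m T)) => //; first exact: fat_ideal.
by apply: sub_addr => //; apply: ideal_exp_ideal.
Qed.

End PointIdeals.

(** * Regularity *)

Section Regularity.
Context (k : fieldType) (n v : nat) (l : 'I_v -> {mpoly k[n.+1]}).
Local Notation R := {mpoly k[n.+1]}.
Local Notation fat := (fat l).
Local Notation M := (irrelevant_ideal k n).
Implicit Types (S T A W : {set 'I_v}) (f g : R) (m d p q w : nat) (j : 'I_v).

Hypothesis n_gt0 : (0 < n)%N.
Hypothesis n_lt_v : (n < v)%N.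
Hypothesis l_linear : forall j, linear_form (l j).
Hypothesis H_meet_n1 : forall s : {set 'I_v}, #|s| = n.+1 ->
  ~ exists p : proj_space k n, forall j, j \in s -> hyperplane (l j) p.
Context (X : {set {set 'I_v}}) (cX : forall S, S \in X -> #|S| = n).

Definition points_in W : set R :=
  \bigcap_(S in [set S | S \in X /\ S \subset W]) point_ideal l S.

(** Truncating in degrees at least w makes the p-th power lie in [M] to the power p w. *)
Definition points_deg W w : set R := points_in W `&` ideal_exp M w.

Lemma points_in_ideal W : is_ideal (points_in W).
Proof. by apply: bigcap_ideal => S _; apply: point_ideal_ideal. Qed.

(** Modulo the n forms of [T], any single further form generates [M]. *)
Lemma irrelevant_exp_congr T (s : seq 'I_v) f : #|T| = n ->
  (forall j, j \in s -> j \notin T) -> ideal_exp M (size s) f ->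
  exists g, point_ideal l T (f - (\prod_(j <- s) l j) * g).
Proof.
have idT := point_ideal_ideal l T.
move=> cT; elim: s f => [|j s IHs] f sT.
  by move=> _; exists f; rewrite big_nil mul1r subrr; case: idT.
move: f; apply: (@ideal_mul_min _ _ _ [set f | exists g, _]).
  exact: congr_principal_ideal.
move=> a b Ma Mb; move: Ma;
  rewrite (@irrelevantE _ _ _ l n_lt_v l_linear H_meet_n1 (j |: T)); last first.
  by rewrite cardsU1 sT ?mem_head // cT.
move=> /point_ideal_add_form[g1 Tg1]; have [|g2 Tg2] := IHs b _ Mb.
  by move=> i si; apply: sT; rewrite inE si orbT.
exists (g1 * g2); rewrite big_cons; set P := \prod_(i <- s) l i in Tg2 *.
have -> : a * b - l j * P * (g1 * g2) = (a - l j * g1) * b + l j * g1 * (b - P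
  * g2).
  by ring.
apply: (@is_idealD _ (point_ideal l T)) => //.
  exact: (@is_idealMr _ (point_ideal l T)).
exact: (@is_idealMl _ (point_ideal l T)).
Qed.

(* The product of the forms indexed by [s] vanishes at all the points in W, but
   not at the point cut out by T. *)
Lemma separating_forms T W w : #|T| = n -> (#|W| + 1 = n + w)%N ->
  ~ (T \in X /\ T \subset W) ->
  exists s : seq 'I_v, [/\ size s = w, forall j, j \in s -> j \notin T
    & forall S, S \in X -> S \subset W -> exists2 j, j \in s & j \in S].
Proof.
move=> cT cW TX; have [TW|TW] := boolP (T \subset W).
  have [||A _ cA] := @card_superset _ T n.+1.
  - by rewrite cT.
  - by rewrite card_ord.
  have /subsetPn[j0 _ j0T] : ~~ (A \subset T).
    by apply/negP => /subset_leq_card; rewrite cA cT ltnn.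
  (* [W :\: T] has only w - 1 elements; [j0], outside [T], brings the length to w. A point in [W]
     other than [T] has an index outside [T]. *)
  exists (j0 :: enum (W :\: T)); split=> [|j|S SX SW].
  - by have := subset_leq_card TW; rewrite /= -cardE cardsDS // cT; move: cW;
    move: #|W| => c; lia.
  - by rewrite inE mem_enum inE => /orP[/eqP ->|/andP[]].
  - have /subsetPn[j jS jT] : ~~ (S \subset T).
      apply/negP => ST; apply: TX; split=> //.
      have /eqP <- // : S == T.
      by rewrite eqEcard ST cT cX //=.
    by exists j; rewrite // inE mem_enum inE jT (fintype.subsetP SW) ?orbT.
(* With n - 1 elements, [A] leaves exactly w forms in [W :\: A] and is too small to contain a
   point. *)
have [|||A [TA AW cA]] := @card_superset_in _ (T :&: W) W n.-1.
- exact: finset.subsetIr.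
- rewrite -ltnS prednK // -cT; apply: proper_card; rewrite finset.properEneq.
  by rewrite finset.subsetIl andbT; apply: contra TW => /eqP/finset.setIidPl.
- by move: cW; lia.
exists (enum (W :\: A)); split=> [|j|S SX SW].
- by rewrite -cardE cardsDS // cA; move: cW; move: #|W| => c; lia.
- rewrite mem_enum inE => /andP[jA jW]; apply: contra jA => jT.
  by apply: (fintype.subsetP TA); rewrite inE jT.
- have /subsetPn[j jS jA] : ~~ (S \subset A).
    by apply/negP => /subset_leq_card; rewrite cX // cA; lia.
  by exists j; rewrite // mem_enum inE jA (fintype.subsetP SW).
Qed.

(** If [T] is a point of the configuration in [W], vanishing there already puts [f] in the ideal of
    [T] when p is positive. Otherwise the separating forms put the w-th power of [M] in
    [points_deg W w] modulo that ideal. *)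
Lemma regularity_point T W w p d f : #|T| = n -> (#|W| + 1 = n + w)%N ->
  ideal_add (ideal_exp M (d + p * w)) (point_ideal l T) f ->
  (forall S, S \in X -> T \subset S -> S \subset W -> fat S p T f) ->
  ideal_add (ideal_mul (ideal_exp M d) (ideal_exp (points_deg W w) p))
    (point_ideal l T) f.
Proof.
move=> cT cW Mf Xf; have idT := point_ideal_ideal l T.
case: p => [|p] in Mf Xf *.
  move: Mf; rewrite mul0n addn0; apply: ideal_addS => // x Mx.
  by rewrite -[x]mulr1; apply: mem_ideal_mul.
have [[TX TW]|TX] := pselect (T \in X /\ T \subset W).
  apply: sub_addr; first exact: ideal_mul_ideal.
  have := Xf T TX (fintype.subxx T) TW; move: f {Mf Xf}.
  apply: ideal_add_min => // x /(@ideal_exp_le _ _ p.+1 1 (ltn0Sn p)).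
  by rewrite ideal_exp1.
have [s [sw sT sX]] := separating_forms cT cW TX.
have Ms : ideal_exp M w `<=` ideal_add (points_deg W w) (point_ideal l T).
  rewrite -sw => x /(irrelevant_exp_congr cT sT)[g Tg].
  exists ((\prod_(j <- s) l j) * g) => //; split.
    move=> S [SX SW]; have [j js jS] := sX S SX SW.
    apply: (@is_idealMr _ (point_ideal l S)); first exact: point_ideal_ideal.
    rewrite (big_rem j) //=; apply: (@is_idealMr _ (point_ideal l S)).
      exact: point_ideal_ideal.
    exact: point_ideal_form.
  apply: (@is_idealMr _ (ideal_exp M (size s))); first exact: ideal_exp_ideal.
  rewrite -sum1_size; apply: ideal_exp_bigprod => j _.
  by rewrite -[l j]expr1; apply: ideal_exp_mem; apply: irrelevant_form.
have idtarget : is_ideal (ideal_add (ideal_mul (ideal_exp M d)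
    (ideal_exp (points_deg W w) p.+1)) (point_ideal l T)).
  by apply: ideal_add_ideal => //; apply: ideal_mul_ideal.
move: f Mf {Xf}; apply: ideal_add_min => // [x|]; last first.
  by apply: sub_addr; apply: ideal_mul_ideal.
move=> /ideal_exp_split Mx; apply: ideal_mul_addr => //.
move: x Mx; apply: ideal_mulS => // x /sub_ideal_exp_exp /(ideal_expS Ms).
apply: ideal_exp_add => //; apply: setI_ideal; first exact: points_in_ideal.
exact: ideal_exp_ideal.
Qed.

Lemma card_setD1_succ W j w : (#|W| + 1 = n + w.+1)%N -> j \in W ->
  (#|W :\ j| + 1 = n + w)%N.
Proof. by move=> + jW; rewrite (cardsD1 j W) jW /=; move: #|_ :\ _| => c; lia. Qed.

(** * Induction step for regularity: one index more in [T], one fewer in [W] *)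

Section Step.
Context (T W : {set 'I_v}) (j : 'I_v) (w : nat).
Hypothesis cT : (#|T| < n)%N.
Hypothesis jT : j \notin T.
Local Notation W' := (W :\ j).
Hypothesis regTj : forall (U : {set 'I_v}) u p d f,
  (#|U| + 1 = n + u)%N ->
  ideal_add (ideal_exp M (d + p * u)) (point_ideal l (j |: T)) f ->
  (forall S, S \in X -> j |: T \subset S -> S \subset U -> fat S p (j |: T) f) ->
  ideal_add (ideal_mul (ideal_exp M d) (ideal_exp (points_deg U u) p))
    (point_ideal l (j |: T)) f.
Hypothesis regW' : forall p d f,
  ideal_add (ideal_exp M (d + p * w)) (point_ideal l T) f ->
  (forall S, S \in X -> T \subset S -> S \subset W' -> fat S p T f) ->
  ideal_add (ideal_mul (ideal_exp M d) (ideal_exp (points_deg W' w) p))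
    (point_ideal l T) f.
Hypothesis cW : (#|W| + 1 = n + w.+1)%N.
Hypothesis jW : j \in W.

Local Notation target p q d :=
  (ideal_mul (ideal_exp M d)
     (ideal_mul (ideal_exp (points_deg W w.+1) p) (ideal_exp (points_deg W' w) q))).

(** Points in [W] that are not in [W'] lie on H_j, so [l j] carries the ideal for [W'] into that for
    [W] and raises the degree by one. *)
Lemma target_mul_form p q d f : target p q.+1 d f -> target p.+1 q d (l j * f).
Proof.
move: f; apply: ideal_mul_colon => [|a b Ma]; first exact: ideal_mul_ideal.
rewrite mulrA; move: b; apply: ideal_mul_colon => [|b c Kb];
  first exact: ideal_mul_ideal.
rewrite mulrA; move: c; apply: ideal_mul_colon => [|c c' [Jc Mc] Kc'].
  exact: ideal_mul_ideal.
have -> : l j * a * b * (c * c') = a * ((l j * c) * b * c') by ring.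
apply: mem_ideal_mul => //; apply: mem_ideal_mul => //; apply: mem_ideal_mul => //.
split; last by apply: mem_ideal_mul => //; apply: irrelevant_form.
move=> S [SX SW]; have idS := point_ideal_ideal l S.
have [jS|jS] := boolP (j \in S).
  by apply: (@is_idealMr _ (point_ideal l S)) => //; apply: point_ideal_form.
apply: (@is_idealMl _ (point_ideal l S)) => //; apply: Jc; split=> //.
by rewrite finset.subsetD1 SW.
Qed.

Lemma target_irrelevant p q d :
  target p q d `<=` ideal_exp M (d + p * w.+1 + q * w).
Proof.
rewrite -addnA; apply: ideal_mul_min => [|a b Ma]; first exact: ideal_exp_ideal.
move: b; apply: ideal_mul_colon => [|b c Kb Kc]; first exact: ideal_exp_ideal.
apply: ideal_expD => //; apply: ideal_expD; apply: ideal_exp_exp.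
  by move: b Kb; apply: ideal_expS => b [].
by move: c Kc; apply: ideal_expS => c [].
Qed.

Lemma target_fat p q d S : S \in X -> S \subset W ->
  target p q d `<=` ideal_exp (point_ideal l S) (if j \in S then p else p + q)%N.
Proof.
move=> SX SW; apply: ideal_mul_min => [|a b Ma]; first exact: ideal_exp_ideal.
move=> Kb; apply: is_idealMl; first exact: ideal_exp_ideal.
move: b Kb; apply: ideal_mul_min => [|b c Kb Kc]; first exact: ideal_exp_ideal.
have {}Kb : ideal_exp (point_ideal l S) p b.
  by move: b Kb; apply: ideal_expS => b [Jb _]; apply: Jb.
case: ifPn => jS; first by apply: is_idealMr => //; apply: ideal_exp_ideal.
apply: ideal_expD => //; move: c Kc; apply: ideal_expS => c [Jc _]; apply: Jc.
by split=> //; rewrite finset.subsetD1 SW.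
Qed.

(** No point in [W'] lies on H_j. So [regTj] for [W'] has no vanishing condition and replaces a
    power of [M] by the q copies of [W'], while [regTj] for [W] provides the p copies. *)
Lemma target_lift p q d f :
  ideal_add (ideal_exp M (d + p * w.+1 + q * w)) (point_ideal l T) f ->
  (forall S, S \in X -> T \subset S -> S \subset W -> j \in S -> fat S p T f) ->
  ideal_add (target p q d) (point_ideal l (j |: T)) f.
Proof.
move=> Mf Xf; have idTj := point_ideal_ideal l (j |: T).
have TTj : point_ideal l T `<=` point_ideal l (j |: T).
  by apply: point_idealS; apply: finset.subsetUr.
have Mq : ideal_exp M (q * w) `<=`
    ideal_add (ideal_exp (points_deg W' w) q) (point_ideal l (j |: T)).
  move=> x Mx; have [||S SX jS SW|g Kg Tg] := @regTj W' w q 0 x.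
  - exact: card_setD1_succ.
  - by apply: sub_addl.
  - have /(fintype.subsetP SW) : j \in S.
      by apply: (fintype.subsetP jS); rewrite !inE eqxx.
    by rewrite !inE eqxx.
  - by exists g => //; move: g Kg {Tg}; apply: ideal_mul_subr;
    apply: ideal_exp_ideal.
have [||S SX jS SW|g Kg Tg] := @regTj W w.+1 p (d + q * w)%N f.
- by [].
- by rewrite addnAC; apply: (ideal_addS _ TTj Mf).
- have jS' : j \in S by apply: (fintype.subsetP jS); rewrite !inE eqxx.
  have TS : T \subset S by apply: fintype.subset_trans jS; apply: finset.subsetUr.
  exact: (ideal_addS _ TTj (Xf S SX TS SW jS')).
have idt : is_ideal (ideal_add (target p q d) (point_ideal l (j |: T))).
  by apply: ideal_add_ideal => //; apply: ideal_mul_ideal.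
rewrite -(subrK g f);
  apply: (@is_idealD _ (ideal_add (target p q d) (point_ideal l (j |: T)))) => //.
  by apply: sub_addr => //; apply: ideal_mul_ideal.
move: g Kg {Tg}; apply: ideal_mul_min => // a b /ideal_exp_split Ma Kb.
rewrite mulrC; move: a Ma; apply: ideal_mul_colon => // a a' Ma /Mq[c Kc Tc].
exists (a * (b * c)); first by apply: mem_ideal_mul => //; apply: mem_ideal_mul.
have -> : b * (a * a') - a * (b * c) = b * a * (a' - c) by ring.
exact: (@is_idealMl _ (point_ideal l (j |: T))).
Qed.

(* Lift from H_j, then divide by l_j: this trades one copy of W for one copy of
   W minus j.  Only the copies of W have points in H_j. *)
Lemma regularity_mixed p q d f :
  ideal_add (ideal_exp M (d + p * w.+1 + q * w)) (point_ideal l T) f ->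
  (forall S, S \in X -> T \subset S -> S \subset W ->
     fat S (if j \in S then p else p + q)%N T f) ->
  ideal_add (target p q d) (point_ideal l T) f.
Proof.
have idT := point_ideal_ideal l T.
elim: p q d f => [|p IHp] q d f Mf Xf.
  have [||g Kg Tg] := @regW' q d f.
  - by move: Mf; rewrite addn0.
  - move=> S SX TS; rewrite finset.subsetD1 => /andP[SW /negPf jS].
    by have := Xf S SX TS SW; rewrite jS.
  exists g => //; move: g Kg {Tg}; apply: ideal_mulS => // x Kx.
  by rewrite -[x]mul1r; apply: mem_ideal_mul.
have [|g tg] := @target_lift p.+1 q d f Mf.
  by move=> S SX TS SW jS; have := Xf S SX TS SW; rewrite jS.
move=> /point_ideal_add_form[h Th].
have lh : forall J, is_ideal J -> ideal_add J (point_ideal l T) f -> J g ->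
    ideal_add J (point_ideal l T) (l j * h).
  move=> J idJ [f' Jf' Tf'] Jg; exists (f' - g); first exact: is_idealB.
  have -> : l j * h - (f' - g) = (f - f') - (f - g - l j * h) by ring.
  exact: (@is_idealB _ (point_ideal l T)).
have [g' tg' Tg'] : ideal_add (target p q.+1 d) (point_ideal l T) h.
  apply: IHp => [|S SX TS SW].
    (* Trading w + 1 for w loses exactly the degree of [l j]. *)
    have -> : (d + p * w.+1 + q.+1 * w = (d + p.+1 * w.+1 + q * w).-1)%N by lia.
    apply: (@irrelevant_colon _ _ _ l n_lt_v l_linear H_meet_n1 T j) => //.
      exact: ltnW.
    by apply: lh => //; [apply: ideal_exp_ideal|apply: target_irrelevant].
  have jh := lh _ (ideal_exp_ideal _ _) (Xf S SX TS SW) (target_fat SX SW tg).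
  have := @fat_colon _ _ _ l n_lt_v l_linear H_meet_n1 S _ T j h jT _ jh.
  rewrite (finset.setUidPl TS) cardsU1 cX //.
  case: (j \in S) => /=; last by rewrite subn0 -addSnnS => H; apply: H.
  by rewrite subn1 add0n => H; apply: H; apply: leqnSn.
exists (g + l j * g').
  by apply: (@is_idealD _ (target p.+1 q d));
    [apply: ideal_mul_ideal| |apply: target_mul_form].
have -> : f - (g + l j * g') = (f - g - l j * h) + l j * (h - g') by ring.
apply: (@is_idealD _ (point_ideal l T)) => //.
exact: (@is_idealMl _ (point_ideal l T)).
Qed.

End Step.

(* Here w is the regularity |W| - n + 1 of the points in W. *)
Lemma regularity T W w p d f : (#|T| <= n)%N -> (#|W| + 1 = n + w)%N ->
  ideal_add (ideal_exp M (d + p * w)) (point_ideal l T) f ->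
  (forall S, S \in X -> T \subset S -> S \subset W -> fat S p T f) ->
  ideal_add (ideal_mul (ideal_exp M d) (ideal_exp (points_deg W w) p))
    (point_ideal l T) f.
Proof.
move=> cT; have [s sT] : exists s, (#|T| + s = n)%N by exists (n - #|T|)%N; lia.
elim: s T sT {cT} W w p d f => [|s IHs] T sT W w p d f.
  by rewrite addn0 in sT; apply: regularity_point.
elim: w W p d f => [|w IHw] W p d f cW Mf Xf.
  (* For w = 0 the set [W] has n - 1 elements and contains no point, so 1 is in [points_deg W 0]. *)
  move: Mf; rewrite muln0 addn0; apply: ideal_addS => // x Mx.
  rewrite -[x]mulr1 -[1](expr1n _ p); apply: mem_ideal_mul => //.
  apply: ideal_exp_mem; split=> // S [SX /subset_leq_card].
  by rewrite cX //; lia.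
have /subsetPn[j jW jT] : ~~ (W \subset T).
  by apply/negP => /subset_leq_card; lia.
have cT : (#|T| < n)%N by lia.
have [||||g tg Tg] := @regularity_mixed T W j w cT jT _ _ cW jW p 0 d f.
- move=> U u p' d' f' cU; apply: IHs => //; rewrite cardsU1 jT; lia.
- by move=> p' d' f'; apply: IHw; apply: card_setD1_succ cW jW.
- by rewrite mul0n addn0.
- by move=> S SX TS SW; rewrite addn0 if_same; apply: Xf.
exists g => //; move: g tg {Tg}; apply: ideal_mulS => //.
by apply: ideal_mul_subl; apply: ideal_exp_ideal.
Qed.

End Regularity.

(** * Initial degrees *)

Section DegreeBounds.
Local Open Scope nat_scope.
Implicit Types (e m q d : nat).

(* The bound on the degree of a form vanishing to order q at the points of a
   configuration of m + e hyperplanes in P^m. *)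
Definition degree_bound e m q d :=
  (forall a, a * m + 1 <= q -> a * (m + e) + e <= d) /\
  (forall a b, 2 <= b -> a * m + b <= q -> a * (m + e) + e + b <= d).

(** Start of the induction on dimension: a form in the plane inherits the bound q e from its
    restriction to a line. *)
Lemma degree_bound_line e q d : 2 <= e -> q * e <= d -> degree_bound e 2 q d.
Proof.
move=> e2 qed; split=> [a aq|a b b2 aq].
  have : (a * 2 + 1) * e <= d by apply: leq_trans qed; rewrite leq_mul2r aq orbT.
  nia.
have : (a * 2 + b) * e <= d by apply: leq_trans qed; rewrite leq_mul2r aq orbT.
nia.
Qed.

(** Regroup a (m + 1) + b as a m + (a + b). The remainder grows with the dimension, which is why the
    second clause lets b be arbitrarily large. *)
Lemma degree_bound_restrict e m q d : degree_bound e m q d -> degree_bound e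
  m.+1 q d.
Proof.
move=> [Pi Pii]; split=> [[|a] aq|a b b2 aq].
- by have := Pi 0; lia.
- by have := Pii a.+1 a.+2; nia.
- by have := Pii a (a + b); nia.
Qed.

(** Division by all m + e forms lowers a by one; for a = 0 and b > m it is b that drops, by m, and b
    = m + 1 falls under the first clause. *)
Lemma degree_bound_peel e m q d : 1 <= e -> 2 <= m -> m + e <= d ->
  degree_bound e m (q - m) (d - (m + e)) -> degree_bound e m q d.
Proof.
move=> e1 m2 md [Pi Pii]; split=> [[|a] aq|[|a] b b2 aq].
- by lia.
- by have := Pi a; nia.
- have [bm|mb] := leqP b m; first by lia.
  have [bm1|bm1] := leqP b m.+1; first by have := Pi 0; lia.
  by have := Pii 0 (b - m); lia.
- by have := Pii a b; nia.
Qed.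

End DegreeBounds.

Section InitialDegree.
Context (k : fieldType) (n e v : nat) (l : 'I_v -> {mpoly k[n.+1]}).
Local Notation R := {mpoly k[n.+1]}.
Local Notation fat := (fat l).
Implicit Types (S T : {set 'I_v}) (f g : R) (m d q : nat) (j : 'I_v).

Hypothesis v_eq : v = (n + e)%N.
Hypothesis e_ge2 : (2 <= e)%N.
Hypothesis l_linear : forall j, linear_form (l j).
Hypothesis H_meet_n1 : forall s : {set 'I_v}, #|s| = n.+1 ->
  ~ exists p : proj_space k n, forall j, j \in s -> hyperplane (l j) p.
Context (X : {set {set 'I_v}}) (cX : forall S, S \in X -> #|S| = n).
Hypothesis X_line : forall T i j, (#|T| + 1 = n)%N ->
  i \notin T -> j \notin T -> i != j -> (i |: T \in X) || (j |: T \in X).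

Let n_lt_v : (n < v)%N.
Proof. by rewrite v_eq; lia. Qed.

Lemma fat_sub_point S T q f : T \subset S -> fat S q.+1 T f -> point_ideal l S f.
Proof.
move=> TS; rewrite -(fat1 l TS); apply: ideal_addS => //.
exact: ideal_exp_le.
Qed.

Lemma fat_le S T m q f : (q <= m)%N -> fat S m T f -> fat S q T f.
Proof. by move=> qm; apply: ideal_addS => //; apply: ideal_exp_le. Qed.

Lemma count_mem_set (s : seq 'I_v) S T : uniq s -> (forall j, j \in s -> j
  \notin T) ->
  T \subset S -> (count (mem S) s + #|T| <= #|S|)%N.
Proof.
move=> us sT TS; rewrite -size_filter addnC -(leq_subRL _ (subset_leq_card TS))
  -cardsDS //.
rewrite cardE; apply: uniq_leq_size; first exact: filter_uniq.
by move=> j; rewrite mem_filter mem_enum => /andP[/= jS /sT jT]; rewrite inE jT.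
Qed.

(** A point containing [T] has n - #|T| further indices, so dividing by the forms of [s] costs at
    most that many orders of vanishing. *)
Lemma peel_step T (s : seq 'I_v) q d f : (#|T| < n)%N -> uniq s ->
  f \is d.-homog -> ~ point_ideal l T f ->
  (forall S, S \in X -> T \subset S -> fat S q T f) ->
  (forall j, j \in s -> j \notin T /\ point_ideal l (j |: T) f) ->
  exists g, [/\ (size s <= d)%N, g \is (d - size s).-homog, ~ point_ideal l T g,
    point_ideal l T (f - (\prod_(j <- s) l j) * g) &
    forall S, S \in X -> T \subset S -> fat S (q - (n - #|T|)) T g].
Proof.
move=> cT us fd fT fX sT.
have [//|[g [sd gd Tg]]] :=
  point_ideal_peel_homog n_lt_v l_linear H_meet_n1 cT us fd sT.
have sT' j : j \in s -> j \notin T by move=> /sT[].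
exists g; split=> //.
  move=> gT; apply: fT; rewrite -(subrK ((\prod_(j <- s) l j) * g) f).
  have idT := point_ideal_ideal l T.
  apply: (@is_idealD _ (point_ideal l T)) => //.
  exact: (@is_idealMl _ (point_ideal l T)).
move=> S SX TS; have /= := fat_congr Tg (fX S SX TS).
move=> /(fat_colon_prod n_lt_v l_linear H_meet_n1 (eq_leq (cX SX)) TS sT').
apply: fat_le; apply: leq_sub2l; rewrite leq_subRL 1?addnC; last exact: ltnW.
by rewrite -(cX SX); apply: count_mem_set.
Qed.

(** The line carries e + 1 intersection points, and by [X_line] at least e of them are in [X].
    Dividing by their forms lowers q by one and the degree by at least e. *)
Lemma line_degree T q d f : (#|T| + 1 = n)%N -> f \is d.-homog ->
  ~ point_ideal l T f -> (forall S, S \in X -> T \subset S -> fat S q T f) ->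
  (q * e <= d)%N.
Proof.
move=> cT; have cT' : (#|T| < n)%N by lia.
elim: q d f => [|q IHq] d f fd fT fX //.
pose G := [set j | (j \notin T) && (j |: T \in X)]%SET.
have sG j : j \in enum G -> j \notin T /\ point_ideal l (j |: T) f.
  rewrite mem_enum inE => /andP[jT jX]; split=> //.
  have TjT : T \subset j |: T by apply: finset.subsetUr.
  exact: fat_sub_point (fX _ jX TjT).
have cG : (e <= size (enum G))%N.
  have cTC : #|~: T| = e.+1 by apply/eqP;
    rewrite -(eqn_add2l #|T|) cardsC card_ord; lia.
  have : (#|~: T :\: G| <= 1)%N.
    apply/card_le1_eqP => i j; rewrite !inE.
    move=> /andP[iX iT] /andP[jX jT]; rewrite iT /= in iX; rewrite jT /= in jX.
    apply/eqP; apply: contraT => ij; have := X_line cT jT iT ij.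
    by rewrite (negbTE iX) (negbTE jX).
  move=> bad; rewrite -cardE -ltnS -cTC -(cardsID G) -addn1.
  by apply: leq_add bad; apply/subset_leq_card/finset.subsetIr.
have [g [sd gd gT Tg gX]] := peel_step cT' (enum_uniq _) fd fT fX sG.
rewrite mulSn; have : (q * e <= d - size (enum G))%N.
  apply: IHq gd gT _ => S SX TS; apply: fat_le (gX S SX TS); lia.
by rewrite leq_subRL //; apply: leq_trans; rewrite leq_add2r.
Qed.

(** Either [f] survives restriction to some further hyperplane, or it is divisible by all the forms
    outside [T], modulo the ideal of [T]. *)
Lemma degree_step T q d f : (#|T| < n)%N -> f \is d.-homog ->
  ~ point_ideal l T f -> (forall S, S \in X -> T \subset S -> fat S q T f) ->
  (exists j, [/\ j \notin T, ~ point_ideal l (j |: T) f &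
     forall S, S \in X -> j |: T \subset S -> fat S q (j |: T) f]) \/
  exists g, [/\ (v - #|T| <= d)%N, g \is (d - (v - #|T|)).-homog,
    ~ point_ideal l T g, point_ideal l T (f - (\prod_(j in ~: T) l j) * g) &
    forall S, S \in X -> T \subset S -> fat S (q - (n - #|T|)) T g].
Proof.
move=> cT fd fT fX.
have [[j [jT fj]]|nj] :=
  pselect (exists j, j \notin T /\ ~ point_ideal l (j |: T) f).
  left; exists j; split=> // S SX jTS.
  have TS : T \subset S by apply: fintype.subset_trans jTS; apply: finset.subsetUr.
  by apply: ideal_addS (fX S SX TS) => //; apply: point_idealS;
    apply: finset.subsetUr.
right; have [|g] := peel_step cT (enum_uniq (~: T)) fd fT fX.
  move=> j; rewrite mem_enum inE => jT; split=> //.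
  by apply: contrapT => fj; apply: nj; exists j.
have -> : size (enum (~: T)) = (v - #|T|)%N.
  by rewrite -cardE cardsCs finset.setCK card_ord.
by rewrite big_enum => H; exists g.
Qed.

(** Restriction is handled by induction on the dimension m, division by an inner induction on the
    degree. *)
Lemma initial_degree m T q d f : (2 <= m)%N -> (#|T| + m = n)%N -> f \is d.-homog ->
  ~ point_ideal l T f -> (forall S, S \in X -> T \subset S -> fat S q T f) ->
  degree_bound e m q d.
Proof.
elim: m T q d f => // m IHm T q d f m2 cT.
have cT' : (#|T| < n)%N by lia.
have [N] := ubnP d; elim: N q d f => // N IHN q d f dN fd fT fX.
case: (degree_step cT' fd fT fX) => [[j [jT fj jX]]|].
  have cjT : (#|j |: T| + m = n)%N by rewrite cardsU1 jT -cT addnS add1n addSn.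
  have [m1|m1] := leqP m 1.
    have -> : m = 1%N by lia.
    apply: degree_bound_line => //; apply: line_degree fd fj jX.
    by move: cjT; have -> : m = 1%N by lia.
  by apply: degree_bound_restrict; apply: IHm fd fj jX.
have -> : (v - #|T| = m.+1 + e)%N by lia.
have -> : (n - #|T| = m.+1)%N by lia.
move=> [g [md gd gT _ gX]]; apply: degree_bound_peel => //; first exact: ltnW.
apply: IHN gd gT gX; lia.
Qed.

Lemma point_ideal_set0 f : point_ideal l finset.set0 f -> f = 0.
Proof.
move: f; apply: (@ideal_gen_min _ _ [set f | f = 0]).
  by split=> //= [f g -> ->|f g ->]; rewrite ?addr0 ?mulr0.
by move=> f [j]; rewrite inE.
Qed.

Lemma fat_set0 S m f : ideal_exp (point_ideal l S) m f <-> fat S m finset.set0 f.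
Proof.
split=> [|[g Sg /point_ideal_set0/eqP]]; first by apply: sub_addl;
  apply: point_ideal_ideal.
by rewrite subr_eq0 => /eqP ->.
Qed.

Lemma initial_degree0 q d f : (2 <= n)%N -> f \is d.-homog -> f != 0 ->
  (forall S, S \in X -> ideal_exp (point_ideal l S) q f) -> degree_bound e n q d.
Proof.
move=> n2 fd f0 fX; apply: (@initial_degree n finset.set0 q d f) => //.
- by rewrite cards0.
- by move=> /point_ideal_set0/eqP; rewrite (negbTE f0).
- by move=> S SX _; apply/fat_set0; apply: fX.
Qed.

(** For n = e = 2 the bound (2 a + 3) e on a line equals (a + 1) v + e, one short of the first
    alternative. *)
Lemma initial_degree_strict a d f : (2 < n)%N \/ n = 2%N /\ (2 < e)%N ->
  f \is d.-homog -> f != 0 ->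
  (forall S, S \in X -> ideal_exp (point_ideal l S) (a.+1 * n + 1) f) ->
  (a.+1 * v + e + 1 <= d)%N \/
  exists g, [/\ (v <= d)%N, g \is (d - v).-homog, f = (\prod_j l j) * g &
    forall S, S \in X -> ideal_exp (point_ideal l S) (a * n + 1) g].
Proof.
move=> n2e fd f0 fX; have n0 : (0 < n)%N by lia.
have fT : ~ point_ideal l finset.set0 f.
  by move=> /point_ideal_set0/eqP; rewrite (negbTE f0).
case: (@degree_step finset.set0 (a.+1 * n + 1) d f _ fd fT).
- by rewrite cards0.
- by move=> S SX _; apply/fat_set0; apply: fX.
- move=> [j [j0 fj jX]]; left; have cj : (#|j |: finset.set0| = 1)%N.
    by rewrite finset.setU0 cards1.
  case: n2e => [n3|[n2 e3]].
    (* On H_j write (a + 1) n + 1 as (a + 1) (n - 1) + (a + 2) and use the second clause. *)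
    have [||_ Pii] := @initial_degree n.-1 (j |: finset.set0) _ _ _ _ _ fd fj
      jX; [lia|rewrite cj; lia|].
    by have := Pii a.+1 a.+2; nia.
  have := @line_degree (j |: finset.set0) _ _ _ _ fd fj jX.
  by rewrite cj n2 => /(_ erefl); nia.
rewrite cards0 !subn0 => -[g [vd gd _ /point_ideal_set0/eqP fE gX]]; right.
exists g; split=> //.
  move: fE; rewrite subr_eq0 => /eqP ->; congr (_ * _).
  by apply: eq_bigl => j; rewrite !inE.
move=> S SX; apply/fat_set0; have := gX S SX (finset.sub0set S).
by apply: fat_le; lia.
Qed.

End InitialDegree.

(** * Containments *)

Lemma dhomog_irrelevant (k : fieldType) (n d : nat) (f : {mpoly k[n.+1]}) :
  f \is d.-homog -> ideal_exp (irrelevant_ideal k n) d f.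
Proof.
move=> fd; rewrite (mpolyE f) big_seq; apply: ideal_sum => [|u uf].
  exact: ideal_exp_ideal.
rewrite -mul_mpolyC; apply: is_idealMl; first exact: ideal_exp_ideal.
rewrite mpolyXE_id -(dhomog_mf fd uf) /= mdegE.
apply: ideal_exp_bigprod => i _; apply: ideal_exp_mem.
by apply: sub_ideal_gen; exists i.
Qed.

Section Containment.
Context (k : fieldType) (n e v : nat) (l : 'I_v -> {mpoly k[n.+1]}).
Local Notation R := {mpoly k[n.+1]}.
Local Notation M := (irrelevant_ideal k n).
Implicit Types (S T : {set 'I_v}) (f g : R) (m d q r : nat) (j : 'I_v).

Hypothesis v_eq : v = (n + e)%N.
Hypothesis e_ge2 : (2 <= e)%N.
Hypothesis n_ge2 : (2 <= n)%N.
Hypothesis l_linear : forall j, linear_form (l j).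
Hypothesis H_meet_n1 : forall s : {set 'I_v}, #|s| = n.+1 ->
  ~ exists p : proj_space k n, forall j, j \in s -> hyperplane (l j) p.
Context (X : {set {set 'I_v}}) (cX : forall S, S \in X -> #|S| = n).
Hypothesis X_line : forall T i j, (#|T| + 1 = n)%N ->
  i \notin T -> j \notin T -> i != j -> (i |: T \in X) || (j |: T \in X).

Let n_lt_v : (n < v)%N.
Proof. by rewrite v_eq; lia. Qed.

Local Notation I := (points_in l X [set: 'I_v]%SET).
Local Notation vanish q f := (forall S, S \in X -> ideal_exp (point_ideal l S) q f).

Lemma vanish_homog q d f : vanish q f -> vanish q (pihomog mdeg d f).
Proof.
move=> fX S SX; apply/fat_set0.
apply: (fat_homog n_lt_v l_linear H_meet_n1); last by apply/fat_set0; apply: fX.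
by rewrite finset.setU0 cX.
Qed.

Lemma vanish_by_homog q (J : set R) : is_ideal J ->
  (forall d f, f \is d.-homog -> f != 0 -> vanish q f -> J f) ->
  forall f, vanish q f -> J f.
Proof.
move=> idJ Jh f fX; rewrite (@pihomog_partitionE _ _ mdeg _ f (leqnn _)).
apply: ideal_sum => // i _; have [->|f0] := eqVneq (pihomog mdeg i f) 0.
  by case: idJ.
by apply: Jh f0 _; [apply: pihomogP|apply: vanish_homog].
Qed.

(** This is [regularity] on the whole space, where w = v - n + 1 = e + 1. *)
Lemma high_degree q r d c f : (r <= q)%N -> f \is d.-homog -> vanish q f ->
  (c + r * e.+1 <= d)%N -> ideal_mul (ideal_exp M c) (ideal_exp I r) f.
Proof.
move=> rq fd fX cd.
have [|||||g tg /point_ideal_set0/eqP] :=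
    @regularity _ _ _ l _ n_lt_v l_linear H_meet_n1 X cX
      finset.set0 [set: 'I_v]%SET e.+1 r c f.
- by lia.
- by rewrite cards0.
- by rewrite cardsT card_ord; lia.
- apply: sub_addl; first exact: point_ideal_ideal.
  by apply: ideal_exp_le cd _ _; apply: dhomog_irrelevant.
- move=> S SX _ _; apply/fat_set0; apply: ideal_exp_le rq _ _.
  exact: fX.
rewrite subr_eq0 => /eqP ->; move: g tg; apply: ideal_mulS => //.
by apply: ideal_expS => x [].
Qed.

Lemma containment_multiple r f : vanish (n * r) f ->
  ideal_mul (ideal_exp M (r * (n - 1))) (ideal_exp I r) f.
Proof.
case: r => [|r].
  by move=> _; rewrite -[f]mulr1; apply: mem_ideal_mul.
move: f; apply: vanish_by_homog => [|d f fd f0 fX]; first exact: ideal_mul_ideal.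
apply: (high_degree _ fd fX); first by nia.
have [_ Pii] := initial_degree0 v_eq e_ge2 l_linear H_meet_n1 cX X_line n_ge2
  fd f0 fX.
(* With a = r and b = n the bound is (r + 1) v, which splits as (r + 1) (n - 1) + (r + 1) (e +
   1). *)
by have := Pii r n n_ge2; nia.
Qed.

(** Any n - 1 of the forms can be set aside for the power of [M]: each point lies on n hyperplanes,
    so the remaining product still vanishes there. *)
Lemma prod_forms_mem : ideal_mul (ideal_exp M (n - 1)) I (\prod_j l j).
Proof.
have [||A _ cA] := @card_superset _ (finset.set0 : {set 'I_v}) (n - 1).
- by rewrite cards0.
- by rewrite card_ord; lia.
rewrite (bigID (mem A)) /=; apply: mem_ideal_mul.
  rewrite -{1}cA -sum1_card; apply: ideal_exp_bigprod => j _.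
  by rewrite -[l j]expr1; apply: ideal_exp_mem; apply: irrelevant_form.
move=> S [SX _]; have /subsetPn[j jS jA] : ~~ (S \subset A).
  by apply/negP => /subset_leq_card; rewrite cX // cA; lia.
rewrite (bigD1 j) //=; apply: (@is_idealMr _ (point_ideal l S)).
  exact: point_ideal_ideal.
exact: point_ideal_form.
Qed.

Lemma containment_prod r g : ideal_mul (ideal_exp M (r * (n - 1))) (ideal_exp I
  r.+1) g ->
  ideal_mul (ideal_exp M (r.+1 * (n - 1))) (ideal_exp I r.+2) ((\prod_j l j) * g).
Proof.
move: g; apply: ideal_mul_colon => [|a b Ma Ib]; first exact: ideal_mul_ideal.
rewrite mulrC; move: prod_forms_mem; move: (\prod_j l j); apply: ideal_mul_colon.
  exact: ideal_mul_ideal.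
move=> c d Mc Id; have -> : a * b * (c * d) = (c * a) * (d * b) by ring.
rewrite mulSn; apply: mem_ideal_mul; first exact: ideal_expD.
exact: mem_ideal_mul.
Qed.

Lemma containment_generic r f : (2 < n)%N \/ n = 2%N /\ (2 < e)%N ->
  vanish (r * n + 1) f ->
  ideal_mul (ideal_exp M (r * (n - 1))) (ideal_exp I r.+1) f.
Proof.
move=> n2e; move: f; apply: vanish_by_homog => [|d f fd f0 fX].
  exact: ideal_mul_ideal.
elim: r d f fd f0 fX => [|r IHr] d f fd f0 fX.
  rewrite -[f]mul1r; apply: mem_ideal_mul => //.
  rewrite -[f]mulr1; apply: mem_ideal_mul => // S [SX _].
  by have := fX S SX; rewrite ideal_exp1 //; apply: point_ideal_ideal.
have [df|[g [vd gd fE gX]]] :=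
  initial_degree_strict v_eq e_ge2 l_linear H_meet_n1 cX X_line n2e fd f0 fX.
  (* Here (r + 1) v + e + 1 = (r + 1) (n - 1) + (r + 2) (e + 1). *)
  by apply: high_degree fd fX _; nia.
rewrite fE; apply: containment_prod; apply: IHr gd _ gX.
by apply: contraNneq f0 => g0; rewrite fE g0 mulr0.
Qed.

(** * Four points in the plane as a complete intersection of two conics *)

Section FourLines.
Context (j1 j2 j3 j4 : 'I_v).
Hypothesis n_eq2 : n = 2%N.
Hypothesis j_uniq : uniq [:: j1; j2; j3; j4].
Hypothesis X13 : [set j1; j3]%SET \in X.
Hypothesis X14 : [set j1; j4]%SET \in X.
Hypothesis X23 : [set j2; j3]%SET \in X.
Hypothesis X24 : [set j2; j4]%SET \in X.
Local Notation conic := (l j3 * l j4).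

(** On the line H_i the conic vanishes simply at the two given points, so it can be divided out q
    times. *)
Lemma conic_line i q f : i \notin [:: j3; j4] ->
  fat l [set i; j3]%SET q [set i]%SET f -> fat l [set i; j4]%SET q [set i]%SET f ->
  exists g, point_ideal l [set i]%SET (f - conic ^+ q * g).
Proof.
move=> i34; have j34 : j3 != j4.
  by move: j_uniq => /= /and4P[_ _]; rewrite inE.
have [ij3 ij4] : i != j3 /\ i != j4 by move: i34; rewrite !inE negb_or => /andP.
have s34 j : j \in [:: j3; j4] -> j \notin [set i]%SET.
  by rewrite !inE => /orP[]/eqP ->; rewrite eq_sym.
have idi := point_ideal_ideal l [set i]%SET.
have ci : (#|[set i]%SET| < n)%N by rewrite cards1 n_eq2.
have sub j : [set i]%SET \subset [set i; j]%SET by rewrite finset.sub1set !inE eqxx.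
have cs j : (#|[set i; j]%SET| <= n)%N by rewrite cards2 n_eq2; case: (i != j).
elim: q f => [|q IHq] f f3 f4.
  by exists f; rewrite mul1r subrr; case: idi.
have us : uniq [:: j3; j4] by rewrite /= !inE j34.
have [j|g Tg] := @point_ideal_peel _ _ _ l n_lt_v l_linear H_meet_n1 [set
  i]%SET [:: j3; j4] f ci us.
  move=> js; split; first exact: s34.
  move: js; rewrite !inE finset.setUC => /orP[]/eqP ->.
    exact: fat_sub_point (sub _) f3.
  exact: fat_sub_point (sub _) f4.
have colon j : j \in [:: j3; j4] -> fat l [set i; j]%SET q.+1 [set i]%SET f ->
    fat l [set i; j]%SET q [set i]%SET g.
  move=> js /(fat_congr Tg).
  move=> /(fat_colon_prod n_lt_v l_linear H_meet_n1 (cs j) (sub j) s34).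
  apply: fat_le; move: js; rewrite /= !inE [j3 == i]eq_sym [j4 == i]eq_sym.
  rewrite (negbTE ij3) (negbTE ij4) /= => /orP[]/eqP ->.
    by rewrite eqxx eq_sym (negbTE j34) [(_ + _)%N](_ : _ = 1%N) // subn1.
  by rewrite eqxx (negbTE j34) [(_ + _)%N](_ : _ = 1%N) // subn1.
have [||h Th] := IHq g; first by apply: colon => //; rewrite !inE eqxx.
  by apply: colon => //; rewrite !inE eqxx orbT.
exists h; rewrite big_cons big_seq1 in Tg.
have -> : f - conic ^+ q.+1 * h = (f - conic * g) + conic * (g - conic ^+ q * h).
  by rewrite exprS; ring.
apply: (@is_idealD _ (point_ideal l [set i]%SET)) => //.
exact: (@is_idealMl _ (point_ideal l [set i]%SET)).
Qed.

Lemma point_ideal_form1 i f : point_ideal l [set i]%SET f -> exists g, f = l i * g.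
Proof.
rewrite -(finset.setU0 [set i]%SET) =>
  /point_ideal_add_form[g /point_ideal_set0/eqP].
by rewrite subr_eq0 => /eqP ->; exists g.
Qed.

Hypothesis conic12 : I (l j1 * l j2).
Hypothesis conic34 : I conic.

(** Subtracting multiples of the q-th power of [conic], which vanishes enough at all four points,
    makes the rest divisible first by [l j1], then by [l j2]. The final quotient vanishes to order
    one less, and the conic [l j1 * l j2] supplies the missing factor. *)
Lemma containment_conics q f : vanish q f ->
  ideal_exp (I `&` ideal_exp M 2) q f.
Proof.
move=> fX; have {fX} : forall i j, i \in [:: j1; j2] -> j \in [:: j3; j4] ->
    fat l [set i; j]%SET q finset.set0 f.
  by move=> i j; rewrite !inE => /orP[]/eqP -> /orP[]/eqP ->; apply/fat_set0/fX.
have quad i j : ideal_exp M 2 (l i * l j).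
  by rewrite -[l j]mulr1; do 2!(apply: mem_ideal_mul => //;
    try exact: irrelevant_form).
have Kconic : (I `&` ideal_exp M 2) conic by [].
have /and4P[/and3P[d12 d13 d14] /andP[d23 d24] _ _] :
    [&& [&& j1 != j2, j1 != j3 & j1 != j4], (j2 != j3) && (j2 != j4), j3 != j4
      & true].
  by move: j_uniq; rewrite /= !inE !negb_or.
have disj i : i \in [:: j1; j2] -> i \notin [:: j3; j4].
  by rewrite !inE negb_or => /orP[]/eqP ->; apply/andP.
elim: q f => [|q IHq] f fX //.
have fat1i i j h m : fat l [set i; j]%SET m finset.set0 h -> fat l [set i;
  j]%SET m [set i]%SET h.
  by apply: ideal_addS => //; apply: point_idealS; apply: finset.sub0set.
have conicq i j m h : j \in [:: j3; j4] -> fat l [set i;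
  j]%SET m finset.set0 (conic ^+ m * h).
  move=> js; apply/fat_set0; apply: is_idealMr; first exact: ideal_exp_ideal.
  apply: ideal_exp_mem; have idS := point_ideal_ideal l [set i; j]%SET.
  have jS : point_ideal l [set i; j]%SET (l j) by apply: point_ideal_form;
    rewrite !inE eqxx orbT.
  move: js jS idS; rewrite !inE => /orP[]/eqP -> jS idS.
    exact: (@is_idealMr _ (point_ideal l _)).
  exact: (@is_idealMl _ (point_ideal l _)).
have colon i i' j m h : i \notin [:: j3; j4] -> i' \notin [:: j3;
  j4] -> j \in [:: j3; j4] ->
    fat l [set i; j]%SET m finset.set0 (l i' * h) ->
    fat l [set i; j]%SET (m - (i' == i)) finset.set0 h.
  move=> i34 i'34 js; have i'j : i' != j by apply: contraNneq i'34 => ->.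
  have := @fat_colon _ _ _ l n_lt_v l_linear H_meet_n1 [set i;
    j]%SET m finset.set0 i' h.
  rewrite !inE (negbTE i'j) orbF finset.setU0; apply=> //.
  by rewrite cardsU1 cards2 n_eq2; case: (_ \notin _); case: (_ != _).
have [j12 j21] : j1 \in [:: j1; j2] /\ j2 \in [:: j1;
  j2] by rewrite !inE !eqxx orbT.
have [j33 j44] : j3 \in [:: j3; j4] /\ j4 \in [:: j3;
  j4] by rewrite !inE !eqxx orbT.
have [|||G /point_ideal_form1[F1 F1E]] := @conic_line j1 q.+1 f.
- exact: disj.
- by apply: fat1i; apply: fX.
- by apply: fat1i; apply: fX.
have F1X i j : i \in [:: j1; j2] -> j \in [:: j3; j4] ->
    fat l [set i; j]%SET (q.+1 - (j1 == i)) finset.set0 F1.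
  move=> ii jj; apply: colon; rewrite ?disj // -F1E.
  apply: (@is_idealB _ (fat l _ _ _)); [exact: fat_ideal|exact: fX|exact: conicq].
have [|||G' /point_ideal_form1[F2 F2E]] := @conic_line j2 q.+1 F1.
- exact: disj.
- by apply: fat1i; have := F1X _ _ j21 j33; rewrite (negbTE d12) subn0.
- by apply: fat1i; have := F1X _ _ j21 j44; rewrite (negbTE d12) subn0.
have F2X i j : i \in [:: j1; j2] -> j \in [:: j3; j4] ->
    fat l [set i; j]%SET q finset.set0 F2.
  move=> ii jj; have := @colon i j2 j (q.+1 - (j1 == i))%N F2 (disj _ ii) (disj
    _ j21) jj.
  rewrite -F2E; have -> : (q.+1 - (j1 == i) - (j2 == i) = q)%N.
    move: ii; rewrite !inE => /orP[]/eqP ->; rewrite eqxx.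
      by rewrite eq_sym (negbTE d12) subn0 subn1.
    by rewrite (negbTE d12) subn0 subn1.
  apply; apply: (@is_idealB _ (fat l _ _ _)); [exact: fat_ideal|exact: F1X|].
  by apply: fat_le (conicq i j q.+1 G' jj); apply: leq_subr.
have -> : f = conic ^+ q.+1 * (G + l j1 * G') + l j1 * l j2 * F2.
  have -> : f = (f - conic ^+ q.+1 * G) + conic ^+ q.+1 * G by ring.
  rewrite F1E; have -> : F1 = (F1 - conic ^+ q.+1 * G') + conic ^+ q.+1 * G' by
    ring.
  by rewrite F2E; ring.
have idK := ideal_exp_ideal (I `&` ideal_exp M 2) q.+1.
apply: (@is_idealD _ (ideal_exp (I `&` ideal_exp M 2) q.+1)) => //.
  by apply: (@is_idealMr _ (ideal_exp _ q.+1)) => //; apply: ideal_exp_mem.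
by apply: mem_ideal_mul => //; apply: IHq.
Qed.

(** Of the 2 r + 1 factors, r are used for their degree and r + 1 for their membership in [I]. *)
Lemma containment_four_lines r f : vanish (r * n + 1) f ->
  ideal_mul (ideal_exp M (r * (n - 1))) (ideal_exp I r.+1) f.
Proof.
have -> : (r * n + 1 = r + r.+1)%N by lia.
have -> : (r * (n - 1) = r)%N by lia.
move=> /containment_conics /ideal_exp_split; move: f; apply: ideal_mulS.
  move=> f Kf; apply: (@ideal_exp_le _ _ (r * 2)); first lia.
  by apply: ideal_exp_exp; move: f Kf; apply: ideal_expS => f [].
by apply: ideal_expS => f [].
Qed.

End FourLines.

End Containment.

(** * Chains of primes in a polynomial ring *)

Section Dimension.
Context (k : fieldType) (m : nat).
Local Notation R := {mpoly k[m]}.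

Lemma card_bmultinom E : (#|{: 'X_{1..m < E}}| <= E ^ m)%N.
Proof.
have lt_E (u : 'X_{1..m < E}) (i : 'I_m) : (bmnm u i < E)%N.
  by apply: leq_ltn_trans (bmdeg u); rewrite mdegE (bigD1 i) //= leq_addr.
pose f (u : 'X_{1..m < E}) := [ffun i : 'I_m => Ordinal (lt_E u i)].
have f_inj : injective f.
  move=> u1 u2 /ffunP f12; apply/val_inj/mnmP => i.
  by have := congr1 val (f12 i); rewrite !ffunE.
by have := leq_card f f_inj; rewrite card_ffun !card_ord.
Qed.

(** The matrix of coefficients has more rows than columns. *)
Lemma mpoly_linear_dependence (T : finType) (p : T -> R) E :
  (forall x, (msize (p x) <= E)%N) -> (E ^ m < #|T|)%N ->
  exists2 u : T -> k, exists x, u x != 0 & \sum_x u x *: p x = 0.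
Proof.
move=> pE ET; pose A : 'M[k]_(#|T|, #|{: 'X_{1..m < E}}|) :=
  \matrix_(i, j) (p (enum_val i))@_(bmnm (enum_val j)).
have : kermx A != 0.
  rewrite kermx_eq0; apply/negP => /eqP rA; have := rank_leq_col A.
  by rewrite rA => /leq_trans/(_ (card_bmultinom E)); rewrite leqNgt ET.
move=> /rowV0Pn[w /sub_kermxP wA w0].
exists (fun x => w 0 (enum_rank x)).
  have [i wi] : exists i, w 0 i != 0.
    apply/existsP; apply: contraNT w0; rewrite negb_exists => /forallP w0.
    apply/eqP/rowP => i; rewrite mxE; apply/eqP; have := w0 i.
    by rewrite negbK.
  by exists (enum_val i); rewrite enum_valK.
apply/mpolyP => u; rewrite mcoeff0 raddf_sum /=.
have [uE|uE] := ltnP (mdeg u) E; last first.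
  apply: big1 => x _; rewrite mcoeffZ memN_msupp_eq0 ?mulr0 //.
  by apply: msize_mdeg_ge; apply: leq_trans uE.
have := congr1 (fun B : 'rV_ _ => B 0 (enum_rank (BMultinom uE))) wA; rewrite !mxE.
apply: etrans; rewrite (reindex _ (onW_bij _ (enum_val_bij T))) /=.
by apply: eq_bigr => i _; rewrite mcoeffZ !mxE enum_valK enum_rankK.
Qed.

Section BoundedMonomials.
Context (N : nat).

(** Nested pairs, so that recursion on h isolates the exponent of the first element of the chain. *)
Fixpoint exponents (h : nat) : finType :=
  if h is h'.+1 then ('I_N * exponents h')%type else unit.

Fixpoint monomial (h : nat) (a : nat -> R) : exponents h -> R :=
  match h with
  | 0 => fun=> 1
  | h'.+1 => fun x => a 0%N ^+ x.1 * monomial (fun i => a i.+1) x.2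
  end.

Lemma card_exponents h : #|exponents h| = (N ^ h)%N.
Proof. by elim: h => [|h IHh] /=;
  rewrite ?card_unit // card_prod IHh card_ord expnS. Qed.

Lemma msize_monomial D h (a : nat -> R) (x : exponents h) :
  (forall i, (i < h)%N -> (msize (a i) <= D.+1)%N) ->
  (msize (monomial a x) <= (h * (N * D)).+1)%N.
Proof.
have degM p q d e : (msize p <= d.+1)%N -> (msize q <= e.+1)%N ->
    (msize (p * q) <= (d + e).+1)%N.
  move=> pd qe; rewrite msizeE; apply/bigmax_leqP_seq => u.
  move=> /msuppM_le/allpairsP[[u1 u2] /= [u1p u2q ->]] _.
  by have := msize_mdeg_lt u1p; have := msize_mdeg_lt u2q; rewrite mdegD; lia.
elim: h a x => [|h IHh] a x aD /=; first by rewrite msize1.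
rewrite mulSn; apply: (degM _ _ _ _); last by apply: IHh => i ih; apply: aD.
have xN := ltn_ord x.1.
apply: (@leq_trans (x.1 * D).+1); last by rewrite ltnS leq_mul2r ltnW ?orbT.
elim: (nat_of_ord _) => [|j IHj]; first by rewrite expr0 msize1.
by rewrite exprS mulSn; apply: (degM _ _ _ _) => //; apply: aD.
Qed.

(* Compare lexicographically: modulo c 1 only the terms of least degree in a 0
   remain, once they are divided by a power of a 0, which is not in c 0. *)
Lemma chain_independent h (c : nat -> set R) (a : nat -> R) :
  (forall i, (i <= h)%N -> prime_ideal (c i)) ->
  (forall i, (i < h)%N -> [/\ c i `<=` c i.+1, c i.+1 (a i) & ~ c i (a i)]) ->
  forall u : exponents h -> k,
  c 0%N (\sum_x u x *: monomial a x) -> forall x, u x = 0.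
Proof.
elim: h c a => [|h IHh] c a c_prime ca u cu.
  move=> []; apply/eqP; apply: contraPT cu => u0.
  have [idc c1 _] := c_prime 0%N (leqnn _).
  rewrite (big_pred1 tt) => [cu|[]//]; apply: c1.
  have -> : 1 = ((u tt)^-1)%:MP * (u tt *: (1 : R)).
    by rewrite mul_mpolyC scalerA mulVf // scale1r.
  exact: is_idealMl.
have [idc0 c01 c0M] := c_prime 0%N (leq0n _).
have [idc1 _ _] := c_prime 1%N (ltn0Sn _).
have [c0c1 c1a c0a] := ca 0%N (ltn0Sn _).
pose t (i : 'I_N) := \sum_x u (i, x) *: monomial (fun i => a i.+1) x.
have {}cu : c 0%N (\sum_(i < N) a 0%N ^+ i * t i).
  have <- : \sum_(x : exponents h.+1) u x *: monomial a x = \sum_(i < N) a 0%N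
    ^+ i * t i.
    under [RHS]eq_bigr => i _ do rewrite mulr_sumr.
    by rewrite pair_bigA; apply: eq_bigr => -[i x] _ /=; rewrite scalerAr.
  by [].
have c0X j y : c 0%N (a 0%N ^+ j * y) -> c 0%N y.
  elim: j => [|j IHj]; first by rewrite mul1r.
  by rewrite exprS -mulrA => /c0M[].
suff step j (i : 'I_N) : (i < j)%N -> forall x, u (i, x) = 0.
  by case=> i x; apply: (step i.+1).
elim: j i => // j IHj i ij.
apply: (IHh (fun i => c i.+1) (fun i => a i.+1)) => [i' i'h|i' i'h|].
- exact: c_prime.
- exact: ca.
rewrite -/(t i).
(* Terms of exponent below i vanish by [IHj], hence the default 0; those above are divided by [a 0]
   to the power i + 1. As [a 0] is in [c 1], so is [t i]. *)
pose w := \sum_(i' < N | i' != i)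
  (if (i < i')%N then a 0%N ^+ (i' - i.+1) * t i' else 0).
have : c 0%N (t i + a 0%N * w).
  apply: (c0X i); move: cu; rewrite (bigD1 i) //= mulrDr; congr (c 0%N (_ + _)).
  rewrite /w !mulr_sumr; apply: eq_bigr => i' i'i.
  case: ltnP => ii'; first by rewrite !mulrA -exprSr -exprD subnKC.
  rewrite !mulr0 /t big1 ?mulr0 // => x _; rewrite IHj ?scale0r //.
  by move: ij; rewrite ltnS; apply: leq_trans; rewrite ltn_neqAle; apply/andP.
move=> /c0c1 c1t; have -> : t i = (t i + a 0%N * w) - a 0%N * w by rewrite addrK.
by apply: is_idealB => //; apply: is_idealMr.
Qed.

End BoundedMonomials.

Lemma prime_chain_length (P : set R) h (c : nat -> set R) :
  prime_chain_to P h c -> (h <= m)%N.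
Proof.
move=> [c_prime c_lt _]; rewrite leqNgt; apply/negP => mh.
have [a aP] : exists a : nat -> R, forall i, (i < h)%N -> c i.+1 (a i) /\ ~ c i
  (a i).
  have aex i : exists x, (i < h)%N -> c i.+1 x /\ ~ c i x.
    have [ih|ih] := boolP (i < h)%N; last by exists 0.
    have [_ /existsNP[x /not_implyP[? ?]]] := c_lt i ih.
    by exists x.
  by have [a aP] := choice aex; exists a.
(* The monomials have size at most E = (m + 1) N D + 1 <= N C, and E^m <= N^m C^m < N^(m + 1), the
   number of monomials, because N = C^m + 1. *)
pose D := \max_(i < m.+1) msize (a i).
pose C := (m.+1 * D).+1.
pose N := (C ^ m).+1.
have aD i : (i < m.+1)%N -> (msize (a i) <= D.+1)%N.
  by move=> im; apply/leqW/(leq_bigmax (Ordinal im)).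
have [||u [x ux] u0] := @mpoly_linear_dependence (exponents N m.+1)
    (@monomial N m.+1 a) (m.+1 * (N * D)).+1.
- by move=> x; apply: msize_monomial.
- rewrite card_exponents expnSr; apply: (@leq_ltn_trans ((N * C) ^ m)).
    have [->|m0] := posnP m; first by rewrite !expn0.
    by rewrite leq_exp2r // /C; nia.
  by rewrite expnMn ltn_pmul2l ?expn_gt0.
have /eqP[] : u x != 0 by [].
apply: (@chain_independent N m.+1 c a) => [i im|i im|].
- by apply: c_prime; apply: leq_trans im mh.
- have ih : (i < h)%N by apply: leq_trans im mh.
  by have [ci _] := c_lt i ih; have [? ?] := aP i ih.
- by rewrite u0; have [[]] := c_prime 0%N (leq0n h).
Qed.

End Dimension.

(** * Associated primes and their heights *)

Lemma prime_ideal_prod (R : comNzRingType) (P : set R) (T : Type) (r : seq T)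
    (F : T -> R) :
  prime_ideal P -> (forall i, ~ P (F i)) -> ~ P (\prod_(i <- r) F i).
Proof.
by move=> [_ P1 PM] PF; elim/big_ind: _ => // x y Px Py /PM[].
Qed.

Section AssociatedPrimes.
Context (k : fieldType) (n v : nat) (l : 'I_v -> {mpoly k[n.+1]}).
Local Notation R := {mpoly k[n.+1]}.
Local Notation M := (irrelevant_ideal k n).
Implicit Types (S T : {set 'I_v}) (f g : R).

Hypothesis n_lt_v : (n < v)%N.
Hypothesis l_linear : forall j, linear_form (l j).
Hypothesis H_meet_n1 : forall s : {set 'I_v}, #|s| = n.+1 ->
  ~ exists p : proj_space k n, forall j, j \in s -> hyperplane (l j) p.

Section Ass.
Context (X : {set {set 'I_v}}) (cX : forall S, S \in X -> #|S| = n).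
Local Notation I := (points_in l X [set: 'I_v]%SET).

(** The product of the forms outside [S] vanishes at every other point but not at [S], so it is the
    required colon element. *)
Lemma assoc_prime_point S : S \in X -> assoc_prime I (point_ideal l S).
Proof.
move=> SX; have prS : prime_ideal (point_ideal l S).
  by apply: (point_ideal_prime n_lt_v l_linear H_meet_n1); rewrite cX.
split=> //; exists (\prod_(j <- enum (~: S)) l j).
apply/seteqP; split=> [g gS S' [S'X _]|g gfI].
  have [<-|SS'] := eqVneq S S'.
    by apply: (@is_idealMr _ (point_ideal l S)) => //; apply: point_ideal_ideal.
  have /subsetPn[j jS' jS] : ~~ (S' \subset S).
    by apply: contra SS' => S'S; rewrite eq_sym eqEcard S'S !cX //=.
  apply: (@is_idealMl _ (point_ideal l S')); first exact: point_ideal_ideal.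
  rewrite big_enum (bigD1 j) ?inE //=.
  apply: (@is_idealMr _ (point_ideal l S')); first exact: point_ideal_ideal.
  exact: point_ideal_form.
have gfS : point_ideal l S (g * \prod_(j <- enum (~: S)) l j).
  by apply: gfI; split=> //; apply: finset.subsetT.
have [_ _ SM] := prS; case: (SM _ _ gfS) => // fS; exfalso; move: fS.
apply: (point_ideal_prod n_lt_v l_linear H_meet_n1) => [|j]; first by rewrite cX.
by rewrite mem_enum inE.
Qed.

(** If [P] were none of the point ideals, each point where [f] does not vanish would give an element
    of its ideal outside [P]. The product of these times [f] is in [I], so the product is in [P],
    against primality. *)
Lemma assoc_primeP P : assoc_prime I P -> exists2 S, S \in X & P = point_ideal l S.
Proof.
move=> [prP [f PE]]; apply: contrapT => nS.
have [idP P1 _] := prP.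
(* The default 1 serves when [S] is not a point or [f] already vanishes there. *)
have /choice[h hP] S : exists h, ~ P h /\ (S \in X -> point_ideal l S (h * f)).
  have [[SX fS]|nSf] := pselect (S \in X /\ ~ point_ideal l S f); last first.
    exists 1; split=> // SX; rewrite mul1r; apply: contrapT => fS.
    by apply: nSf.
  have idS := point_ideal_ideal l S.
  have PS : P `<=` point_ideal l S.
    have [|_ _ SM] := @point_ideal_prime _ _ _ l n_lt_v l_linear H_meet_n1 S.
      by rewrite cX.
    rewrite PE => g /(_ S)/= gf; have /SM[//|] : point_ideal l S (g * f).
      by apply: gf; split=> //; apply: finset.subsetT.
    by [].
  have [h hS hP] : exists2 h, point_ideal l S h & ~ P h.
    apply: contrapT => nh; apply: nS; exists S => //.
    apply/seteqP; split=> // h hS; apply: contrapT => hP.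
    by apply: nh; exists h.
  by exists h; split=> // _; apply: (@is_idealMr _ (point_ideal l S)).
apply: (prime_ideal_prod (r := enum [set: {set 'I_v}]%SET) prP (fun S => (hP S).1)).
rewrite PE => S [SX _]; rewrite big_enum (bigD1 S) ?inE //= mulrAC.
apply: (@is_idealMr _ (point_ideal l S)); first exact: point_ideal_ideal.
exact: (hP S).2.
Qed.

End Ass.

Lemma point_ideal_sub_irrelevant S : (#|S| <= n)%N -> point_ideal l S `<` M.
Proof.
move=> cS; have [|A SA cA] := @card_superset _ S n.+1 (leqW cS).
  by rewrite card_ord.
rewrite (irrelevantE n_lt_v l_linear H_meet_n1 cA); split;
  first exact: point_idealS.
have /subsetPn[j jA jS] : ~~ (A \subset S).
  by apply/negP => /subset_leq_card; rewrite cA => /leq_trans/(_ cS); rewrite ltnn.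
move=> /(_ (l j) (@point_ideal_form _ _ _ l _ _ jA)).
exact: (point_ideal_formN n_lt_v l_linear H_meet_n1).
Qed.

Lemma irrelevant_prime : prime_ideal M.
Proof.
have [||A _ cA] := @card_superset _ (finset.set0 : {set 'I_v}) n.+1.
- by rewrite cards0.
- by rewrite card_ord.
rewrite (irrelevantE n_lt_v l_linear H_meet_n1 cA).
by apply: (point_ideal_prime n_lt_v l_linear H_meet_n1); rewrite cA.
Qed.

Lemma point_ideal_chain S : (#|S| <= n)%N ->
  exists c, prime_chain_to (point_ideal l S) #|S| c.
Proof.
move=> cS; pose T i := [set j in take i (enum S)]%SET.
have TE i : (i < #|S|)%N -> exists2 j, j \notin T i & T i.+1 = j |: T i.
  move=> iS; have j0 : 'I_v by move: (ltn0Sn i) iS; rewrite cardE; case: (enum S).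
  have us := take_uniq i.+1 (enum_uniq S).
  rewrite (take_nth j0) -?cardE // rcons_uniq in us; case/andP: us => jT _.
  exists (nth j0 (enum S) i); first by rewrite inE.
  by apply/setP => j; rewrite !inE (take_nth j0) -?cardE // mem_rcons inE.
have cT i : (i <= #|S|)%N -> #|T i| = i.
  elim: i => [|i IHi] iS; first by rewrite /T take0 cardsE card0.
  by have [j jT ->] := TE i iS; rewrite cardsU1 jT IHi // ltnW.
exists (fun i => point_ideal l (T i)); split=> [i iS|i iS|].
- apply: (point_ideal_prime n_lt_v l_linear H_meet_n1); rewrite cT //.
  by apply: leq_trans iS (leqW cS).
- have [j jT ->] := TE i iS; split; first by apply: point_idealS;
  apply: finset.subsetUr.
  have jj : j \in j |: T i by rewrite !inE eqxx.
  move=> /(_ (l j) (@point_ideal_form _ _ _ l _ _ jj)).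
  apply: (point_ideal_formN n_lt_v l_linear H_meet_n1) => //.
  by rewrite cT ?(ltnW iS) //; apply: leq_trans (ltnW iS) cS.
- congr (point_ideal l _); apply/setP => j; rewrite inE take_oversize -?cardE //.
  by rewrite mem_enum.
Qed.

Lemma point_ideal_height S : #|S| = n -> has_height (point_ideal l S) n.
Proof.
move=> cS; split; first by have := @point_ideal_chain S; rewrite cS; apply.
move=> h c [c_prime c_lt cS']; rewrite -ltnS.
pose c' i := if (i <= h)%N then c i else M.
apply: (@prime_chain_length k n.+1 M h.+1 c'); split=> [i|i|].
- by move=> _; rewrite /c'; case: (leqP i h) => [/c_prime|_] //;
  apply: irrelevant_prime.
- rewrite ltnS /c' => ih; rewrite ih; case: (ltnP i h) => [/c_lt //|hi].
  have -> : i = h by apply/eqP; rewrite eqn_leq ih.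
  by rewrite cS'; apply: point_ideal_sub_irrelevant; rewrite cS.
- by rewrite /c' ltnn.
Qed.

End AssociatedPrimes.

(** * Steiner systems *)

Section SteinerSystems.
Context (t n v : nat) (B : {set {set 'I_v}}).
Hypothesis t_ge1 : (1 <= t)%N.
Hypothesis t_lt_n : (t < n)%N.
Hypothesis n_lt_v : (n < v)%N.
Hypothesis steinerB : steiner_system t n B.
Implicit Types (S T b : {set 'I_v}).

Lemma steiner_card b : b \in B -> #|b| = n.
Proof. by case: steinerB => + _; apply. Qed.

Lemma steiner_uniq T b b' : (t <= #|T|)%N -> b \in B -> b' \in B ->
  T \subset b -> T \subset b' -> b = b'.
Proof.
move=> tT bB b'B Tb Tb'.
have [|T' [_ T'T cT']] :=
  @card_superset_in _ finset.set0 T t (finset.sub0set T) _ tT.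
  by rewrite cards0.
case: steinerB => _ /(_ T' cT')[b0 [_ b0P]].
apply: (@etrans _ _ b0); [symmetry|]; apply: b0P; apply/andP; split=> //.
  exact: fintype.subset_trans T'T Tb.
exact: fintype.subset_trans T'T Tb'.
Qed.

Lemma steiner_block T : (#|T| <= t)%N -> exists2 b, b \in B & T \subset b.
Proof.
move=> Tt; have [|T' TT' cT'] := card_superset Tt.
  by rewrite card_ord; lia.
case: steinerB => _ /(_ T' cT')[b0 [/andP[bB Tb] _]].
by exists b0 => //; apply: fintype.subset_trans TT' Tb.
Qed.

Definition steiner_complement : {set {set 'I_v}} :=
  [set S : {set 'I_v} | (#|S| == n) && (S \notin B)]%SET.

Lemma steiner_complement_card S : S \in steiner_complement -> #|S| = n.
Proof. by rewrite inE => /andP[/eqP]. Qed.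

(** Exchange an element of a block for one outside it, keeping t elements: the new set shares those
    t with the block, so it is not a block. *)
Lemma steiner_complement_neq0 : exists S, S \in steiner_complement.
Proof.
have [|b bB _] := @steiner_block finset.set0; first by rewrite cards0.
have cb := steiner_card bB.
have [||T [_ Tb cT]] := @card_superset_in _ finset.set0 b t (finset.sub0set b).
- by rewrite cards0.
- by rewrite cb; apply: ltnW.
have [x xb xT] : exists2 x, x \in b & x \notin T.
  by apply/subsetPn/negP => /subset_leq_card; rewrite cT cb; lia.
have [y _ yb] : exists2 y, y \in [set: 'I_v]%SET & y \notin b.
  by apply/subsetPn/negP => /subset_leq_card; rewrite cardsT card_ord cb; lia.
have yb' : y \notin b :\ x by rewrite inE (negbTE yb) andbF.
exists (y |: (b :\ x)); rewrite inE cardsU1 yb' (cardsD1 x b) in cb *.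
rewrite -cb xb eqxx /=; apply/negP => b'B.
have /setP/(_ y) : b = y |: (b :\ x).
  apply: (@steiner_uniq T) => //; first by rewrite cT.
  by apply: fintype.subset_trans (finset.subsetUr _ _); rewrite finset.subsetD1 Tb.
by rewrite !inE eqxx (negbTE yb).
Qed.

(** Otherwise two distinct blocks would share n - 1 >= t elements. *)
Lemma steiner_complement_line T i j : (#|T| + 1 = n)%N ->
  i \notin T -> j \notin T -> i != j ->
  (i |: T \in steiner_complement) || (j |: T \in steiner_complement).
Proof.
move=> cT iT jT ij; rewrite !inE !cardsU1 iT jT add1n -addn1 cT eqxx /=.
rewrite -negb_and; apply/negP => /andP[iB jB].
have /setP/(_ i) : i |: T = j |: T.
  by apply: (@steiner_uniq T) => //; [lia|apply: finset.subsetUr..].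
by rewrite !inE eqxx (negbTE ij) (negbTE iT).
Qed.

(** If v = n + 1, a block and a block through the point it omits meet in at least n - 1 >= t
    elements, so they coincide. *)
Lemma steiner_size : (n + 2 <= v)%N.
Proof.
rewrite leqNgt; apply/negP => vn; have {vn} v_eq : v = n.+1 by lia.
have [|b bB _] := @steiner_block finset.set0; first by rewrite cards0.
have cb := steiner_card bB.
have [x _ xb] : exists2 x, x \in [set: 'I_v]%SET & x \notin b.
  by apply/subsetPn/negP => /subset_leq_card; rewrite cardsT card_ord cb; lia.
have [|b' b'B xb'] := @steiner_block [set x]%SET; first by rewrite cards1.
have bb' : b = b'.
  apply: (@steiner_uniq (b :&: b')) => //;
    rewrite ?finset.subsetIl ?finset.subsetIr //.
  rewrite cardsI cb (steiner_card b'B).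
  have : (#|b :|: b'| <= n.+1)%N.
    by rewrite -[X in (_ <= X)%N]v_eq -[X in (_ <= X)%N]card_ord max_card.
  lia.
by move: xb'; rewrite -bb' finset.sub1set (negbTE xb).
Qed.

End SteinerSystems.

Section FourPoints.
Context (v : nat) (B : {set {set 'I_v}}).
Hypothesis v_eq4 : v = 4%N.
Hypothesis steinerB : steiner_system 1 2 B.
Local Notation X := (steiner_complement 2 B).

(* A Steiner system S(1,2,4) is a partition of four points into two pairs. *)
Lemma steiner_pairs : exists j1 j2 j3 j4 : 'I_v,
  [/\ uniq [:: j1; j2; j3; j4],
      forall i j, i \in [:: j1; j2] -> j \in [:: j3; j4] -> [set i; j]%SET \in X
    & forall S, S \in X -> (j1 \in S) || (j2 \in S) /\ (j3 \in S) || (j4 \in S)].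
Proof.
have v2 : (2 < v)%N by rewrite v_eq4.
have [|b bB _] := @steiner_block 1 2 v B isT isT v2 steinerB finset.set0.
  by rewrite cards0.
have /eqP := steiner_card steinerB bB; move=> /cards2P[j1 [j2 [j12 bE]]].
have [j3 _ j3b] : exists2 x, x \in [set: 'I_v]%SET & x \notin b.
  apply/subsetPn/negP => /subset_leq_card.
  by rewrite cardsT card_ord (steiner_card steinerB bB) v_eq4.
have [|b' b'B] := @steiner_block 1 2 v B isT isT v2 steinerB [set j3]%SET.
  by rewrite cards1.
rewrite finset.sub1set => j3b'.
have b'3 : #|b' :\ j3| = 1%N.
  have := steiner_card steinerB b'B; rewrite (cardsD1 j3) j3b' => -[].
  by [].
have /eqP/cards1P[j4 b'4] := b'3.
have b'E : b' = [set j3; j4]%SET by rewrite -(finset.setD1K j3b') b'4.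
have sep x : x \in b -> x \in b' -> False.
  move=> xb xb'; have bb' : b = b'.
    by apply: (@steiner_uniq 1 2 v B steinerB [set x]%SET);
      rewrite ?cards1 ?finset.sub1set.
  by rewrite bb' j3b' in j3b.
have j43 : j4 != j3.
  have : j4 \in b' :\ j3 by rewrite b'4 inE.
  by rewrite !inE => /andP[].
exists j1, j2, j3, j4; split.
- have dis x y : x \in b -> y \in b' -> x != y.
    by move=> xb yb'; apply/eqP => xy; apply: (sep x) => //; rewrite xy.
  have [j1b j2b] : j1 \in b /\ j2 \in b by rewrite bE !inE !eqxx orbT.
  have j4b' : j4 \in b' by rewrite b'E !inE eqxx orbT.
  by rewrite /= !inE !negb_or j12 !(dis j1) // !(dis j2) // eq_sym j43.
- move=> i j; rewrite !inE -!(finset.in_set2) -bE -b'E => ib jb'.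
  have ij : i != j by apply/eqP => ij; apply: (sep i) => //; rewrite ij.
  rewrite cards2 ij /=; apply/negP => ijB.
  have bij : b = [set i; j]%SET.
    by apply: (@steiner_uniq 1 2 v B steinerB [set i]%SET);
      rewrite ?cards1 ?finset.sub1set ?inE ?eqxx.
  by apply: (sep j) => //; rewrite bij !inE eqxx orbT.
(* A pair avoiding one block is its complement, which is the other block. *)
- have compl b0 b1 S : b0 \in B -> b1 \in B -> (forall x, x \in b0 -> x \in b1
  -> False) ->
      S \in X -> exists2 x, x \in b0 & x \in S.
    move=> b0B b1B sep01 SX; apply: contrapT => nS.
    have Sb0 : S \subset ~: b0.
      by apply/fintype.subsetP => x xS; rewrite inE; apply/negP => xb0;
        apply: nS; exists x.
    have b1b0 : b1 \subset ~: b0.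
      by apply/fintype.subsetP => x xb1; rewrite inE; apply/negP => xb0;
        apply: (sep01 x).
    have cb0 : #|~: b0| = 2%N.
      by apply/eqP; rewrite -(eqn_add2l #|b0|) cardsC card_ord (steiner_card
        steinerB b0B) v_eq4.
    have /eqP S_eq : S == ~: b0.
      by rewrite eqEcard Sb0 cb0 (steiner_complement_card SX).
    have /eqP b1_eq : b1 == ~: b0.
      by rewrite eqEcard b1b0 cb0 (steiner_card steinerB b1B).
    by move: SX; rewrite inE S_eq -b1_eq b1B andbF.
  move=> S SX; have [x xb xS] := compl b b' S bB b'B sep SX.
  have [y yb' yS] := compl b' b S b'B bB (fun z zb' zb => sep z zb zb') SX.
  split.
    by move: xb xS; rewrite bE !inE => /orP[]/eqP -> ->; rewrite ?orbT.
  by move: yb' yS; rewrite b'E !inE => /orP[]/eqP -> ->; rewrite ?orbT.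
Qed.

End FourPoints.

Lemma complement_idealE (k : fieldType) (n v : nat) (B : {set {set 'I_v}})
    (l : 'I_v -> {mpoly k[n.+1]}) :
  complement_ideal B l = points_in l (steiner_complement n B) [set: 'I_v]%SET.
Proof.
apply/seteqP; split=> f fI S.
  by case; rewrite inE => /andP[/eqP cS SB] _; apply: fI.
by case=> cS SB; apply: fI; split; rewrite ?finset.subsetT // inE cS eqxx.
Qed.

Theorem theorem3p5 (k : fieldType) (t n v : nat)
    (t_ge1 : (1 <= t)%N) (t_lt_n : (t < n)%N) (n_lt_v : (n < v)%N)
    (B : {set {set 'I_v}}) (steinerB : steiner_system t n B)
    (l : 'I_v -> {mpoly k[n.+1]})
    (l_linear : forall j, linear_form (l j))
    (l_neq0 : forall j, l j != 0)
    (H_distinct : injective (fun j => hyperplane (l j)))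
    (H_meet_n : forall s : {set 'I_v}, #|s| = n ->
       exists! p : proj_space k n, forall j, j \in s -> hyperplane (l j) p)
    (H_meet_n1 : forall s : {set 'I_v}, #|s| = n.+1 ->
       ~ exists p : proj_space k n, forall j, j \in s -> hyperplane (l j) p) :
  let I := complement_ideal B l in
  let M := irrelevant_ideal k n in
  [/\ exists r0 : nat, forall r : nat, (r0 <= r)%N ->
        symbolic_power I (n * r)
          `<=` ideal_mul (ideal_exp M (r * (n - 1))) (ideal_exp I r) /\
        symbolic_power I (n * r - n + 1)
          `<=` ideal_mul (ideal_exp M ((r - 1) * (n - 1))) (ideal_exp I r),
      exists r0 : nat, forall r : nat, (r0 <= r)%N ->
        symbolic_power I (n * r - n + 1) `<=` ideal_exp I r
    & has_big_height I n].
Proof.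
move=> I M; rewrite /I complement_idealE; set X := steiner_complement n B.
have n2 : (2 <= n)%N by apply: leq_ltn_trans t_ge1 t_lt_n.
have cX S : S \in X -> #|S| = n by apply: steiner_complement_card.
have XI S : S \in X -> assoc_prime (points_in l X [set: 'I_v]%SET) (point_ideal
  l S).
  exact: assoc_prime_point.
have v2 := steiner_size t_ge1 t_lt_n n_lt_v steinerB.
have [e v_eq e2] : exists2 e, v = (n + e)%N & (2 <= e)%N by exists (v - n)%N; lia.
have X_line := steiner_complement_line t_ge1 t_lt_n n_lt_v steinerB.
have symb q f : symbolic_power (points_in l X [set: 'I_v]%SET) q f ->
    forall S, S \in X -> ideal_exp (point_ideal l S) q f.
  by move=> fq S SX; apply: fq; apply: XI.
have part2 r f : symbolic_power (points_in l X [set: 'I_v]%SET) (n * r - n + 1) f ->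
    ideal_mul (ideal_exp M ((r - 1) * (n - 1)))
      (ideal_exp (points_in l X [set: 'I_v]%SET) r) f.
  (* At r = 0 truncated subtraction makes both powers on the right the unit ideal. *)
  case: r => [|r] /symb fX.
    by rewrite -[f]mulr1; apply: mem_ideal_mul.
  have {}fX S : S \in X -> ideal_exp (point_ideal l S) (r * n + 1) f.
    by move=> /fX; rewrite mulnS addKn mulnC.
  rewrite subn1 /=; have [n2e|n2e] := pselect ((2 < n)%N \/ n = 2%N /\ (2 < e)%N).
    exact: (containment_generic v_eq e2 n2 l_linear H_meet_n1 cX X_line n2e fX).
  (* Only the parameters of S(1, 2, 4) remain. *)
  have n_eq2 : n = 2%N by lia.
  have e_eq2 : e = 2%N by lia.
  have t_eq1 : t = 1%N by lia.
  have v_eq4 : v = 4%N by lia.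
  have st : steiner_system 1 2 B by rewrite -n_eq2 -{1}t_eq1.
  have [j1 [j2 [j3 [j4 [j_uniq XE XS]]]]] := steiner_pairs v_eq4 st.
  rewrite -n_eq2 -/X in XE XS.
  have IS S i j : S \in X -> (i \in S) || (j \in S) -> point_ideal l S (l i * l j).
    have idS := point_ideal_ideal l S.
    move=> SX /orP[]ij; [apply: (@is_idealMr _ (point_ideal l S))
      |apply: (@is_idealMl _ (point_ideal l S))] => //; exact: point_ideal_form.
  apply: (containment_four_lines v_eq e2 n2 l_linear H_meet_n1 n_eq2 j_uniq) => //;
    try by apply: XE; rewrite !inE eqxx ?orbT.
  - by move=> S [SX _]; apply: IS => //; case: (XS S SX).
  - by move=> S [SX _]; apply: IS => //; case: (XS S SX).
split.
(* The containments hold for every r, so the threshold is 0. *)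
- exists 0%N => r _; split=> f; last exact: part2.
  by move=> /symb; apply: (containment_multiple v_eq e2 n2 l_linear H_meet_n1
    cX X_line).
- exists 0%N => r _ f /part2; apply: ideal_mul_subr; exact: ideal_exp_ideal.
- have hgt S : S \in X -> has_height (point_ideal l S) n.
    by move=> SX; apply: point_ideal_height => //; apply: cX.
  split; last first.
    by move=> P /(assoc_primeP n_lt_v l_linear H_meet_n1 cX)[S SX ->];
      exists n; first exact: hgt.
  have [S SX] := steiner_complement_neq0 t_ge1 t_lt_n n_lt_v steinerB.
  by exists (point_ideal l S); [apply: XI|apply: hgt].
Qed.
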